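(* Let $\pi_s$ be the Poisson bivector field dual to a $U(n+1)$-invariant symplectic form on $\mathbb{CP}^n$, let $\pi_\infty$ be the Bruhat Poisson structure on $\mathbb{CP}^n$, and let $$f_j=\frac{\pi_\infty^{\wedge j}\wedge\pi_s^{\wedge(n-j)}}{\pi_s^{\wedge n}},\qquad 1\le j\le n,$$ be the complete family of integrals in involution on $\mathbb{CP}^n$ obtained by the bi-hamiltonian approach from $\pi_\infty$ and $\pi_s$. Then the $f_j$ are expressed by the elementary polynomials in the Gelfand–Tsetlin coordinates $\mu_1^1,\dots,\mu_1^n$ on $\mathbb{CP}^n$, viewed as a coadjoint orbit of $U(n+1)$: up to constant multiples, $$f_j=\sum_{i_1<\cdots<i_j}\mu_1^{i_1}\cdots\mu_1^{i_j},\qquad 1\le j\le n.$$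
   Context: Let $[Z_0:\cdots:Z_n]$ be homogeneous coordinates on $\mathbb{CP}^n$. The quotient defining $f_j$ means the unique smooth function with $f_j\,\pi_s^{\wedge n}=\pi_\infty^{\wedge j}\wedge\pi_s^{\wedge(n-j)}$. ''In involution'' means that the $f_j$ pairwise Poisson commute with respect to both $\pi_s$ and $\pi_\infty$. Bruhat Poisson structure: with $z_i=Z_i/Z_0$ on the largest Bruhat cell $\{Z_0\neq0\}$, $\pi_\infty$ is the smooth Poisson structure on $\mathbb{CP}^n$ whose restriction to this cell is $$\pi_\infty=\sqrt{-1}\sum_{i=1}^n(1+|y_i|^2)\,\partial_{y_i}\wedge\partial_{\bar y_i},\qquad y_i=\frac{z_i}{\sqrt{1+|z_{i+1}|^2+\cdots+|z_n|^2}},$$ where $y_1,\dots,y_n$ are complex-valued (non-holomorphic) smooth coordinates on the cell and $\partial_{y_i},\partial_{\bar y_i}$ are the associated Wirtinger vector fields. Gelfand–Tsetlin coordinates: identify $\mathfrak{u}(m)^*$ with $\mathfrak{u}(m)$ via $-\mathrm{Tr}(AB)$. Fix $\lambda>0$ (which may be taken equal to one) and let $B$ be the $(n+1)\times(n+1)$ matrix whose only nonzero entry is $\sqrt{-1}\lambda$ in the upper left corner. Its coadjoint orbit $\mathcal{O}_B=\{ABA^{-1}:A\in U(n+1)\}$ is identified with $\mathbb{CP}^n$ by sending $ABA^{-1}$, $A=(a_{ij})$, to $[a_{11}:a_{21}:\cdots:a_{n+1,1}]$ in the homogeneous coordinates $[Z_0:\cdots:Z_n]$. For $1\le k\le n$,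 let $\sqrt{-1}\mu_1^k,\dots,\sqrt{-1}\mu_{n+1-k}^k$ with $\mu_1^k\ge\mu_2^k\ge\cdots$ be the eigenvalues of the image of $ABA^{-1}$ under the projection $\mathfrak{u}(n+1)^*\to\mathfrak{u}(n+1-k)^*$ dual to the embedding $U(n+1-k)\hookrightarrow U(n+1)$ in the upper left corner. The functions $\mu_r^k$ on $\mathbb{CP}^n$ are the Gelfand–Tsetlin coordinates; for $r\neq1$ they vanish identically.
   Formalization: The orbit is identified with CP^n by sending ABA^{-1} to [a_11 : a_{n+1,1} : a_{n,1} : ... : a_21] instead of [a_11 : a_21 : ... : a_{n+1,1}]; with the printed order the formula is false for every n >= 2. *)

(* Defs.v *)
From HB Require Import structures.
From mathcomp Require Import all_boot all_order all_algebra spectral.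
From mathcomp Require Import complex.
From mathcomp Require Import all_classical all_reals all_analysis.

Set Implicit Arguments.
Unset Strict Implicit.
Unset Printing Implicit Defensive.

Import Order.TTheory GRing.Theory Num.Theory numFieldNormedType.Exports.
Local Open Scope ring_scope.
Local Open Scope complex_scope.
Local Open Scope classical_set_scope.

Section Smooth.
Variables (R : realType) (m : nat).
Implicit Types (F : 'rV[R]_m -> R) (w : 'rV[R]_m).

Fixpoint Ck (k : nat) F : Prop :=
  if k is k'.+1 then
    (forall w, differentiable F w) /\ (forall v, Ck k' (fun w => 'D_v F w))
  else continuous F.

Definition smooth F : Prop := forall k, Ck k F.

Definition partial (a : 'I_m) F w : R := 'D_(delta_mx 0 a) F w.

End Smooth.

(* The exterior algebra of R^m in the basis e_S = e_{s1} /\ ... /\ e_{sp},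
   S = {s1 < ... < sp}. *)
Section Exterior.
Variables (R : realType) (m : nat).

Definition multivector := {ffun {set 'I_m} -> R}.

(* e_S /\ e_T = shuffle_sign S T * e_(S :|: T) for disjoint S and T. *)
Definition shuffle_sign (S T : {set 'I_m}) : R :=
  (-1) ^+ #|[set p : 'I_m * 'I_m | [&& p.1 \in S, p.2 \in T & (p.2 < p.1)%N]]%SET|.

Definition wedge (A B : multivector) : multivector :=
  [ffun S : {set 'I_m} => \sum_(T : {set 'I_m} | T \subset S)
     shuffle_sign T (S :\: T) * A T * B (S :\: T)].

Definition wedge_pow (A : multivector) (p : nat) : multivector :=
  iter p (wedge A) [ffun S : {set 'I_m} => (S == finset.set0)%:R].

(* The skew matrix P stands for sum_(a < b) P a b * e_a /\ e_b. *)
Definition bivector_of (P : 'M[R]_m) : multivector :=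
  [ffun S : {set 'I_m} =>
     \sum_(a < m) \sum_(b < m | (a < b)%N && (S == [set a; b]%SET)) P a b].

End Exterior.

Section ProjectiveSpace.
Variables (R : realType) (n : nat).
Local Notation C := R[i].

Definition CP := {L : {vspace 'rV[C]_n.+1} | \dim L == 1%N}.

Lemma dim_line (Z : 'rV[C]_n.+1) : Z != 0 -> \dim <[Z]>%VS == 1%N.
Proof. by move=> Z0; rewrite dim_vline Z0. Qed.

Definition CPpoint (Z : 'rV[C]_n.+1) (Z0 : Z != 0) : CP :=
  exist _ <[Z]>%VS (dim_line Z0).

(* C^n = R^(n+n): the real parts come first, then the imaginary parts. *)
Definition to_complex (w : 'rV[R]_(n + n)) : 'rV[C]_n :=
  \row_i (w 0 (lshift n i) +i* w 0 (rshift n i)).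

Definition to_real (z : 'rV[C]_n) : 'rV[R]_(n + n) :=
  row_mx (\row_i complex.Re (z 0 i)) (\row_i complex.Im (z 0 i)).

Definition chart (k : 'I_n.+1) (Z : 'rV[C]_n.+1) : 'rV[R]_(n + n) :=
  to_real (\row_j (Z 0 (lift k j) / Z 0 k)).

(* The inverse of chart k; it is onto the open set where Z_k <> 0. *)
Definition homog (k : 'I_n.+1) (w : 'rV[R]_(n + n)) : 'rV[C]_n.+1 :=
  \row_i (if unlift k i is Some j then to_complex w 0 j else 1).

Lemma homog_neq0 k w : homog k w != 0.
Proof.
apply/eqP => /rowP /(_ k); rewrite !mxE unlift_none => /eqP.
by rewrite oner_eq0.
Qed.

Definition param (k : 'I_n.+1) (w : 'rV[R]_(n + n)) : CP :=
  CPpoint (homog_neq0 k w).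

Definition smooth_CP (F : CP -> R) : Prop :=
  forall k, smooth (fun w => F (param k w)).

(* [Z] |-> [g Z] read from chart k to chart l; homogeneous coordinates are
   stored as row vectors. *)
Definition act (g : 'M[C]_n.+1) (k l : 'I_n.+1) (w : 'rV[R]_(n + n)) :
    'rV[R]_(n + n) :=
  chart l (homog k w *m g^T).

Definition act_dom (g : 'M[C]_n.+1) (k l : 'I_n.+1) (w : 'rV[R]_(n + n)) :=
  (homog k w *m g^T) 0 l != 0.

(* Components of a 2-tensor field in each of the n+1 affine charts. *)
Definition tensor_field := 'I_n.+1 -> 'rV[R]_(n + n) -> 'M[R]_(n + n).

Definition smooth_skew (T : tensor_field) : Prop :=
  (forall k a b, smooth (fun w => T k w a b)) /\
  (forall k w, (T k w)^T = - T k w).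

(* [jacobian] acts on row vectors on the right, so tangent vectors push forward
   by u |-> u *m J. *)
Definition pushforward (J P : 'M[R]_(n + n)) := J^T *m P *m J.
Definition pullback (J O : 'M[R]_(n + n)) := J *m O *m J^T.

Definition bivector_field (P : tensor_field) : Prop :=
  smooth_skew P /\
  forall k l w, act_dom 1%:M k l w ->
    P l (act 1%:M k l w) = pushforward (jacobian (act 1%:M k l) w) (P k w).

Definition preserves_form (g : 'M[C]_n.+1) (om : tensor_field) : Prop :=
  forall k l w, act_dom g k l w ->
    om k w = pullback (jacobian (act g k l) w) (om l (act g k l w)).

Definition two_form (om : tensor_field) : Prop :=
  smooth_skew om /\ preserves_form 1%:M om.

Definition closed_form (om : tensor_field) : Prop :=
  forall k w a b c,
    partial a (fun w => om k w b c) w + partial b (fun w => om k w c a) w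
    + partial c (fun w => om k w a b) w = 0.

Definition symplectic_form (om : tensor_field) : Prop :=
  [/\ two_form om, closed_form om & forall k w, om k w \in unitmx].

Definition unitary_invariant (om : tensor_field) : Prop :=
  forall g : 'M[C]_n.+1, g \is unitarymx -> preserves_form g om.

(* alpha |-> alpha *m dual_bivector om is the inverse of u |-> om(u, -). *)
Definition dual_bivector (om : tensor_field) : tensor_field :=
  fun k w => invmx (om k w).

Definition jacobi_identity (P : tensor_field) : Prop :=
  forall k w a b c, \sum_d
    (P k w a d * partial d (fun w => P k w b c) w
     + P k w b d * partial d (fun w => P k w c a) w
     + P k w c d * partial d (fun w => P k w a b) w) = 0.

Definition poisson_structure (P : tensor_field) : Prop :=
  bivector_field P /\ jacobi_identity P.

Definition sqabs (z : C) : R := complex.Re z ^+ 2 + complex.Im z ^+ 2.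

Definition y_coord (w : 'rV[R]_(n + n)) : 'rV[R]_(n + n) :=
  to_real (\row_i (to_complex w 0 i /
    (Num.sqrt (1 + \sum_(m < n | (i < m)%N) sqabs (to_complex w 0 m)))%:C)).

(* Wirtinger vectors and their wedge, as complexified tangent vectors and
   skew matrices of components. *)
Definition d_y (i : 'I_n) : 'rV[C]_(n + n) :=
  2^-1 *: (delta_mx 0 (lshift n i) - 'i *: delta_mx 0 (rshift n i)).

Definition d_ybar (i : 'I_n) : 'rV[C]_(n + n) :=
  2^-1 *: (delta_mx 0 (lshift n i) + 'i *: delta_mx 0 (rshift n i)).

Definition wedge_vec (u v : 'rV[C]_(n + n)) : 'M[C]_(n + n) :=
  u^T *m v - v^T *m u.

Definition bruhat_mx (y : 'rV[R]_(n + n)) : 'M[C]_(n + n) :=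
  'i *: \sum_i (1 + sqabs (to_complex y 0 i))%:C *: wedge_vec (d_y i) (d_ybar i).

Definition bruhat_poisson (P : tensor_field) : Prop :=
  poisson_structure P /\
  forall w, map_mx (real_complex R) (pushforward (jacobian y_coord w) (P ord0 w))
            = bruhat_mx (y_coord w).

Definition bihamiltonian_quotient (pinf ps : tensor_field) (j : nat)
    (F : CP -> R) : Prop :=
  smooth_CP F /\
  forall k w (S : {set 'I_(n + n)}),
    F (param k w) * wedge_pow (bivector_of (ps k w)) n S =
    wedge (wedge_pow (bivector_of (pinf k w)) j)
          (wedge_pow (bivector_of (ps k w)) (n - j)) S.

Definition orbit_mx (lambda : R) (A : 'M[C]_n.+1) : 'M[C]_n.+1 :=
  A *m (('i * lambda%:C) *: delta_mx ord0 ord0) *m invmx A.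

(* A *m B *m A^-1 corresponds to [a_11 : a_(n+1)1 : a_n1 : ... : a_21]: the
   basis vectors 2, ..., n+1 are matched with Z_n, ..., Z_1.  With this order the
   corner U(n+1-k) of U(n+1) acts on Z_0, Z_n, ..., Z_(k+1), that is, on the
   variables entering y_(k+1), ..., y_n (cf. [y_coord]).  In the order
   Z_0, Z_1, ..., Z_n the chain of corners would not be adapted to [y_coord],
   and its spectra are not those of the pair of Poisson structures if n >= 2. *)
Definition orbit_point (A : 'M[C]_n.+1) : 'rV[C]_n.+1 :=
  \row_i A (if unlift ord0 i is Some j then lift ord0 (rev_ord j) else ord0) ord0.

Lemma corner_size (k : 'I_n) : (n - k <= n.+1)%N.
Proof. by rewrite leqW // leq_subr. Qed.

(* The index k : 'I_n stands for k+1, so the corner has size n+1-(k+1) = n-k. *)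
Definition corner (k : 'I_n) (M : 'M[C]_n.+1) : 'M[C]_(n - k) :=
  mxsub (widen_ord (corner_size k)) (widen_ord (corner_size k)) M.

Definition corner_embedding (k : 'I_n) (X : 'M[C]_(n - k)) : 'M[C]_n.+1 :=
  let E := rowsub (widen_ord (corner_size k)) 1%:M in E^T *m X *m E.

Lemma corner_dual (k : 'I_n) (X : 'M[C]_(n - k)) (M : 'M[C]_n.+1) :
  - \tr (corner_embedding X *m M) = - \tr (X *m corner k M).
Proof.
rewrite /corner_embedding; set f := widen_ord _.
have -> : corner k M = rowsub f 1%:M *m M *m (rowsub f 1%:M)^T.
  apply/matrixP => i j; rewrite mul_rowsub_mx mul1mx !mxE (bigD1 (f j)) //=.
  rewrite !mxE eqxx mulr1 big1 ?addr0 // => l lj.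
  by rewrite !mxE eq_sym (negbTE lj) mulr0.
by rewrite -!mulmxA mxtrace_mulC !mulmxA.
Qed.

(* mu_1 >= mu_2 >= ... such that the i * mu_r are the eigenvalues of M, with
   multiplicity. *)
Definition imaginary_spectrum m (M : 'M[C]_m) : seq R :=
  xget [::] [set s : seq R | sorted >=%R s /\
    char_poly M = \prod_(x <- s) ('X - ('i * x%:C)%:P)].

(* Both indices start at 0: this is mu_(r+1)^(k+1). *)
Definition gt_coord (lambda : R) (A : 'M[C]_n.+1) (k : 'I_n) (r : nat) : R :=
  nth 0 (imaginary_spectrum (corner k (orbit_mx lambda A))) r.

End ProjectiveSpace.

(* Main.v *)
(* Let r_k = 1 + sum_(m >= k) |z_m|^2 and theta_k = arg z_k on the cell Z_0 <> 0
   (indices from 0, r_n = 1, theta_n = 0), and put mu_k = r_(k+1) / r_0 and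
   phi_k = theta_(k+1) - theta_k.  Where no z_k vanishes, y_k has the angle theta_k
   and 1 + |y_k|^2 = r_k / r_(k+1), so that the Bruhat structure has, up to a
   constant, the brackets {mu_k, phi_l} = delta_kl mu_k, all others being 0.  An
   invariant 2-form is determined by its value at one point, which commutes with
   signs and permutations of the coordinates, hence is a multiple of the
   Fubini-Study form; summation by parts turns that form into a multiple of
   sum_k dmu_k /\ dphi_k.  So pi_s = c sum_k b_k and pi_inf = d sum_k mu_k b_k with
   commuting decomposable bivectors b_k of square 0 and nonzero product, and
   comparing coefficients of t^j in
   (sum_k (1 + t mu_k) b_k)^n = n! prod_k (1 + t mu_k) b_k gives
   f_j = (d/c)^j e_j(mu) / binomial(n, j).  The k-th corner of A B A^-1 has rank one
   and top eigenvalue lambda mu_k; both sides being continuous, the identity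
   extends from these generic points to all of CP^n. *)

Require Import Defs.
From HB Require Import structures.
From mathcomp Require Import all_boot all_order all_algebra spectral.
From mathcomp Require Import complex.
From mathcomp Require Import all_classical all_reals all_analysis.
From mathcomp Require Import fingroup perm zify ring.

Set Implicit Arguments.
Unset Strict Implicit.
Unset Printing Implicit Defensive.

Import Order.TTheory GRing.Theory Num.Theory numFieldNormedType.Exports.
Local Open Scope ring_scope.

(** * The exterior algebra as a ring *)

Section ExteriorRing.
Variables (R : realType) (m : nat).
Implicit Types (S T U : {set 'I_m}) (A B C : multivector R m).

(** The sign counts inversions between two sets, and the inversions of a disjoint union are split
    between its parts. Together with the analogous rule on the right, this carries the signs through
    associativity. *)
Lemma shuffle_signUl S T U : [disjoint S & T] ->
  shuffle_sign R (S :|: T) U = shuffle_sign R S U * shuffle_sign R T U.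
Proof.
move=> dST; rewrite /shuffle_sign -exprD; congr (_ ^+ _).
rewrite -cardsUI [X in (_ + X)%N]eq_card0 ?addn0; last first.
  move=> p; rewrite !inE; apply/negP => /andP[/and3P[pS _ _] /and3P[pT _ _]].
  by have := disjointFr dST pS; rewrite pT.
by apply: eq_card => p; rewrite !inE; case: (p.1 \in S); case: (p.1 \in T);
  case: (p.2 \in U); case: (_ < _)%N.
Qed.

Lemma shuffle_signUr S T U : [disjoint T & U] ->
  shuffle_sign R S (T :|: U) = shuffle_sign R S T * shuffle_sign R S U.
Proof.
move=> dTU; rewrite /shuffle_sign -exprD; congr (_ ^+ _).
rewrite -cardsUI [X in (_ + X)%N]eq_card0 ?addn0; last first.
  move=> p; rewrite !inE; apply/negP => /andP[/and3P[_ pT _] /and3P[_ pU _]].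
  by have := disjointFr dTU pT; rewrite pU.
by apply: eq_card => p; rewrite !inE; case: (p.2 \in T); case: (p.2 \in U);
  case: (p.1 \in S); case: (_ < _)%N.
Qed.

Lemma shuffle_sign0l S : shuffle_sign R finset.set0 S = 1.
Proof. by rewrite /shuffle_sign eq_card0 ?expr0 // => p; rewrite !inE. Qed.

Lemma shuffle_sign0r S : shuffle_sign R S finset.set0 = 1.
Proof. by rewrite /shuffle_sign eq_card0 ?expr0 // => p; rewrite !inE andbF. Qed.

Lemma shuffle_sign_neq0 S T : shuffle_sign R S T != 0.
Proof. by rewrite /shuffle_sign signr_eq0. Qed.

Lemma wedgeA : associative (@wedge R m).
Proof.
move=> A B C; apply/ffunP => S; rewrite !ffunE.
under [RHS]eq_bigr => W WS do rewrite ffunE mulr_sumr mulr_suml /=.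
rewrite [RHS](exchange_big_dep (fun T => T \subset S)) /=; last first.
  by move=> W T WS /fintype.subset_trans; apply.
apply: eq_bigr => T TS; rewrite ffunE mulr_sumr.
(* Both sides run over the ordered partitions of [S] into three blocks; with [W = T :|: V] the
   blocks are [T], [V] and the rest. *)
rewrite [RHS](reindex_onto (fun V => T :|: V) (fun W => W :\: T)) /=; last first.
  move=> W /andP[_ TW]; apply/setP => p; rewrite !inE.
  by case: (boolP (p \in T)) => //= /(fintype.subsetP TW) ->.
apply: eq_big => [V|V].
  rewrite finset.subsetUl andbT finset.subUset TS /= finset.subsetD; congr (_ && _).
  apply/idP/eqP => [dVT|<-].
    by apply/setP => p; rewrite !inE; case: (boolP (p \in T)) => //= pT;
      rewrite (disjointFl dVT pT).
  by rewrite disjoint_sym disjoint_subset; apply/fintype.subsetP => p pT;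
    rewrite !inE pT.
rewrite finset.subsetD => /andP[VS dVT].
have dTV : [disjoint T & V] by rewrite disjoint_sym.
have -> : (T :|: V) :\: T = V.
  by apply/setP => p; rewrite !inE; case: (boolP (p \in T)) => //= pT;
    rewrite (disjointFl dVT pT).
have -> : S :\: T :\: V = S :\: (T :|: V) by rewrite finset.setDDl.
have {1}-> : S :\: T = V :|: (S :\: (T :|: V)).
  apply/setP => p; rewrite !inE; case: (boolP (p \in V)) => //= pV.
  + by rewrite (disjointFr dVT pV) (fintype.subsetP VS).
  + by rewrite orbF.
rewrite shuffle_signUr ?shuffle_signUl //; first by ring.
by rewrite disjoint_subset; apply/fintype.subsetP => p pV; rewrite !inE pV orbT.
Qed.

Definition ext_one : multivector R m :=
  [ffun S : {set 'I_m} => (S == finset.set0)%:R].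

Lemma wedge1l : left_id ext_one (@wedge R m).
Proof.
move=> A; apply/ffunP => S; rewrite ffunE (bigD1 finset.set0) ?finset.sub0set //=.
rewrite finset.setD0 ffunE eqxx shuffle_sign0l !mul1r big1 ?addr0 // => T /andP[_ T0].
by rewrite ffunE (negbTE T0) mulr0 mul0r.
Qed.

Lemma wedge1r : right_id ext_one (@wedge R m).
Proof.
move=> A; apply/ffunP => S; rewrite ffunE (bigD1 S) //=.
rewrite finset.setDv ffunE eqxx shuffle_sign0r mul1r mulr1 big1 ?addr0 // => T.
move=> /andP[TS nTS]; rewrite ffunE finset.setD_eq0; case: (boolP (S \subset T)).
  by move=> ST; rewrite finset.eqEsubset TS ST in nTS.
by rewrite mulr0.
Qed.

Lemma wedgeDl : left_distributive (@wedge R m) +%R.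
Proof.
move=> A B C; apply/ffunP => S; rewrite !ffunE -big_split; apply: eq_bigr => T _.
by rewrite !ffunE /=; ring.
Qed.

Lemma wedgeDr : right_distributive (@wedge R m) +%R.
Proof.
move=> A B C; apply/ffunP => S; rewrite !ffunE -big_split; apply: eq_bigr => T _.
by rewrite !ffunE /=; ring.
Qed.

(** A separate name for the type of multivectors, so that its ring product is the wedge and not the
    pointwise product of functions. *)
Definition ext := {ffun {set 'I_m} -> R}.

HB.instance Definition _ := GRing.Lmodule.copy ext {ffun {set 'I_m} -> R^o}.
HB.instance Definition _ :=
  GRing.Zmodule_isPzRing.Build ext wedgeA wedge1l wedge1r wedgeDl wedgeDr.

Lemma ext_scaleE (a : R) (A : ext) S : (a *: A) S = a * A S.
Proof. by rewrite ffunE. Qed.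

Lemma ext_scaleAl (a : R) (A B : ext) : a *: (A * B) = a *: A * B.
Proof.
apply/ffunP => S; rewrite ext_scaleE !ffunE mulr_sumr; apply: eq_bigr => T _.
by rewrite ext_scaleE; ring.
Qed.

Lemma ext_scaleAr (a : R) (A B : ext) : a *: (A * B) = A * (a *: B).
Proof.
apply/ffunP => S; rewrite ext_scaleE !ffunE mulr_sumr; apply: eq_bigr => T _.
by rewrite ext_scaleE; ring.
Qed.

Lemma ext_one_neq0 : (1 : ext) != 0.
Proof.
apply/eqP => /ffunP /(_ finset.set0); rewrite !ffunE eqxx => /eqP.
by rewrite oner_eq0.
Qed.

HB.instance Definition _ := GRing.PzSemiRing_isNonZero.Build ext ext_one_neq0.
HB.instance Definition _ := GRing.Lmodule_isLalgebra.Build R ext ext_scaleAl.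
HB.instance Definition _ := GRing.Lalgebra_isAlgebra.Build R ext ext_scaleAr.

Lemma wedge_powE (A : ext) p : wedge_pow A p = A ^+ p.
Proof. by elim: p => [//|p IHp]; rewrite exprS -IHp. Qed.

Definition ext_basis (a : 'I_m) : ext := [ffun S : {set 'I_m} => (S == [set a]%SET)%:R].

Lemma ext_basisM a (A : ext) S : (ext_basis a * A) S =
  (a \in S)%:R * shuffle_sign R [set a]%SET (S :\ a) * A (S :\ a).
Proof.
rewrite ffunE; have [aS|aS] := boolP (a \in S); last first.
  rewrite !mul0r big1 // => T TS; rewrite ffunE; case: eqP => [Ta|_]; last by rewrite mulr0 mul0r.
  by rewrite Ta finset.sub1set (negbTE aS) in TS.
rewrite (bigD1 [set a]%SET) ?finset.sub1set //= ffunE eqxx big1 ?addr0;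
  first by rewrite mul1r mulr1.
by move=> T /andP[_ Ta]; rewrite ffunE (negbTE Ta) mulr0 mul0r.
Qed.

Lemma shuffle_sign11 (a b : 'I_m) :
  shuffle_sign R [set a]%SET [set b]%SET = (-1) ^+ (b < a)%N.
Proof.
rewrite /shuffle_sign; congr (_ ^+ _); case: (ltnP b a) => ab /=.
  rewrite -[RHS](cards1 (a, b)); apply: eq_card => -[p q]; rewrite !inE xpair_eqE /=.
  by case: eqP => //= ->; case: eqP => //= ->; rewrite ab.
by apply: eq_card0 => -[p q]; rewrite !inE /=; case: eqP => //= ->;
  case: eqP => //= ->; rewrite ltnNge ab.
Qed.

Lemma ext_basis2 (a b : 'I_m) S : a != b ->
  (ext_basis a * ext_basis b) S = (-1) ^+ (b < a)%N * (S == [set a; b]%SET)%:R.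
Proof.
move=> ab; rewrite ext_basisM ffunE; have [->|Sab] := eqVneq S [set a; b]%SET.
  have -> : [set a; b]%SET :\ a = [set b]%SET.
    by apply/setP => p; rewrite !inE; case: (p =P a) => // ->; rewrite (negbTE ab).
  by rewrite eqxx !inE eqxx shuffle_sign11 mul1r.
have [Sb|] := eqVneq (S :\ a) [set b]%SET; last by rewrite !mulr0.
have [aS|_] := boolP (a \in S); last by rewrite !mul0r mulr0.
by rewrite -(finset.setD1K aS) Sb eqxx in Sab.
Qed.

Lemma ext_basis_sqr a : ext_basis a * ext_basis a = 0.
Proof.
apply/ffunP => S; rewrite ext_basisM !ffunE; case: eqP => [Sa|_]; last by rewrite mulr0.
by have : a \in S :\ a by [rewrite Sa inE]; rewrite !inE eqxx.
Qed.

Lemma ext_basis_anti a b : ext_basis a * ext_basis b = - (ext_basis b * ext_basis a).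
Proof.
have [->|ab] := eqVneq a b; first by rewrite ext_basis_sqr oppr0.
have ba : b != a by rewrite eq_sym.
apply/ffunP => S; rewrite [RHS]ffunE !ext_basis2 // finset.setUC.
rewrite -mulNr; congr (_ * _); move: ab; rewrite -val_eqE.
by case: (ltngtP a b) => //= _ _; rewrite ?expr1 ?expr0 ?opprK.
Qed.

Definition ext_vec (u : 'rV[R]_m) : ext := \sum_a u 0 a *: ext_basis a.

Lemma ext_vec_anti u v : ext_vec u * ext_vec v = - (ext_vec v * ext_vec u).
Proof.
rewrite /ext_vec !mulr_suml -sumrN.
under eq_bigr => a _ do rewrite mulr_sumr.
under [RHS]eq_bigr => a _ do rewrite mulr_sumr -sumrN.
rewrite exchange_big; apply: eq_bigr => a _; apply: eq_bigr => b _.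
rewrite -!scalerAl -!scalerAr !scalerA ext_basis_anti scalerN.
by rewrite [in RHS]mulrC.
Qed.

Lemma ext_vec_sqr u : ext_vec u * ext_vec u = 0.
Proof.
apply/eqP; have /eqP := ext_vec_anti u u; rewrite -addr_eq0 -mulr2n -scaler_nat.
by rewrite scaler_eq0 pnatr_eq0.
Qed.

Lemma bivector_of_wedge (u v : 'rV[R]_m) :
  bivector_of (u^T *m v - v^T *m u) = ext_vec u * ext_vec v.
Proof.
have -> : ext_vec u * ext_vec v = \sum_(a < m) \sum_(b < m | (a < b)%N)
    (u 0 a * v 0 b - v 0 a * u 0 b) *: (ext_basis a * ext_basis b).
  have -> : ext_vec u * ext_vec v =
      \sum_a \sum_b (u 0 a * v 0 b) *: (ext_basis a * ext_basis b).
    rewrite /ext_vec mulr_suml; apply: eq_bigr => a _; rewrite mulr_sumr.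
    by apply: eq_bigr => b _; rewrite -scalerAl -scalerAr scalerA.
  (* The diagonal drops out because squares vanish; the part below the diagonal is then transposed
     and folded, with a sign, onto the part above it. *)
  transitivity (\sum_(a < m) \sum_(b < m | (a < b)%N)
      (u 0 a * v 0 b) *: (ext_basis a * ext_basis b) +
    \sum_(a < m) \sum_(b < m | (b < a)%N)
      (u 0 a * v 0 b) *: (ext_basis a * ext_basis b)).
    rewrite -big_split; apply: eq_bigr => a _.
    rewrite (bigID (fun b : 'I_m => (a < b)%N)) /=; congr (_ + _).
    rewrite (bigD1 a) ?ltnn //= ext_basis_sqr scaler0 add0r; apply: eq_bigl => b.
    by rewrite -val_eqE /=; case: ltngtP.
  rewrite [X in _ + X](exchange_big_dep predT) //= -big_split /=.
  apply: eq_bigr => a _; rewrite -big_split /=; apply: eq_bigr => b ab.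
  by rewrite [X in _ + X *: _]mulrC [ext_basis b * _]ext_basis_anti scalerN scalerBl.
apply/ffunP => S; rewrite /bivector_of ffunE sum_ffunE; apply: eq_bigr => a _.
rewrite sum_ffunE big_mkcondr; apply: eq_bigr => b ab; rewrite ext_scaleE.
rewrite ext_basis2 ?ltnNge ?(ltnW ab) ?expr0 ?mul1r; last by rewrite -val_eqE ltn_eqF.
case: ifP => _; last by rewrite mulr0.
by rewrite mulr1 !mxE !big_ord1 !mxE.
Qed.

Lemma bivector_of_sum n (F : 'I_n -> 'M[R]_m) :
  bivector_of (\sum_i F i) = \sum_i (bivector_of (F i) : ext).
Proof.
apply/ffunP => S; rewrite ffunE sum_ffunE.
under [RHS]eq_bigr => i _ do rewrite ffunE.
rewrite exchange_big; apply: eq_bigr => a _; rewrite exchange_big.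
by apply: eq_bigr => b _; rewrite summxE.
Qed.

Lemma bivector_ofZ (x : R) (P : 'M[R]_m) :
  bivector_of (x *: P) = x *: (bivector_of P : ext).
Proof.
apply/ffunP => S; rewrite ext_scaleE !ffunE mulr_sumr; apply: eq_bigr => a _.
by rewrite mulr_sumr; apply: eq_bigr => b _; rewrite mxE.
Qed.

End ExteriorRing.

(** * Products of anticommuting elements and powers of sums of commuting square-zero elements *)

Section AnticommutingProducts.
Variables (E : nzRingType) (I : eqType) (x : I -> E).
Hypothesis x_anti : forall i j, x i * x j = - (x j * x i).

Lemma anti_mul_prod i s :
  x i * \prod_(j <- s) x j = (-1) ^+ size s * (\prod_(j <- s) x j * x i).
Proof.
elim: s => [|j s IHs]; first by rewrite big_nil mulr1 !mul1r.
rewrite big_cons mulrA x_anti mulNr -[_ * x i * _]mulrA IHs /= exprS.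
by rewrite mulN1r mulNr !mulrA [x j * _]commr_sign.
Qed.

(** By induction on [s]: its head is located in [t] and pulled to the front through the prefix [p],
    at the cost of one sign for each element of [p]. *)
Lemma anti_prod_perm s t : perm_eq s t ->
  exists e : bool, \prod_(i <- t) x i = (-1) ^+ e * \prod_(i <- s) x i.
Proof.
elim: s t => [|i s IHs] t st.
  by exists false; move: st; rewrite perm_sym => /perm_nilP->; rewrite mul1r.
have it : i \in t by rewrite -(perm_mem st) mem_head.
case/splitPr: it st => p q st.
have [|e spq] := IHs (p ++ q).
  by rewrite -(perm_cons i) (perm_trans st) // -cat1s perm_catCA.
exists (e (+) odd (size p)).
rewrite big_cat !big_cons /= mulrA.
have -> : \prod_(j <- p) x j * x i = (-1) ^+ size p * (x i * \prod_(j <- p) x j).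
  by rewrite anti_mul_prod mulrA -exprD addnn -signr_odd odd_double mul1r.
rewrite -!mulrA -big_cat /= spq signr_addb signr_odd [(-1) ^+ e * (-1) ^+ _]commr_sign.
by rewrite -!mulrA; congr (_ * _); rewrite !mulrA [x i * _]commr_sign.
Qed.

(** A repeated factor can be moved, up to sign, next to its twin. *)
Lemma anti_prod_nuniq s : (forall i, x i * x i = 0) -> ~~ uniq s ->
  \prod_(i <- s) x i = 0.
Proof.
move=> x_sqr; elim: s => [//|i s IHs] /=; rewrite negb_and negbK big_cons.
case/orP => [iS|/IHs->]; last by rewrite mulr0.
have := perm_to_rem iS; rewrite perm_sym => /anti_prod_perm[e ->].
rewrite big_cons mulrA [x i * _]commr_sign -mulrA [x i * (x i * _)]mulrA x_sqr.
by rewrite mul0r mulr0.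
Qed.

End AnticommutingProducts.

Section SquareZero.
Variables (R : realType) (E : algType R) (I : Type) (b : I -> E).
Hypotheses (b_comm : forall i j, b i * b j = b j * b i) (b_sqr : forall i, b i * b i = 0).

(** The binomial expansion stops after the term linear in [y]. *)
Lemma exprDn_sqr0 (y A : E) k : y * y = 0 -> A * y = y * A ->
  (y + A) ^+ k.+1 = A ^+ k.+1 + k.+1%:R *: (y * A ^+ k).
Proof.
move=> yy Ay; elim: k => [|k IHk]; first by rewrite !expr1 expr0 mulr1 scale1r addrC.
rewrite exprS IHk mulrDl !mulrDr -!scalerAr [y * (y * _)]mulrA yy mul0r scaler0 addr0.
rewrite [A * (y * _)]mulrA Ay -mulrA -!exprS addrCA; congr (_ + _).
by rewrite [k.+2%:R]mulrS scalerDl scale1r.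
Qed.

(** The vanishing of the next power is carried along for the induction: when an element is added, it
    removes the term of the expansion that is free of that element. *)
Lemma expr_sum_sqr0 (x : I -> R) s :
  (\sum_(i <- s) x i *: b i) ^+ size s =
    ((size s)`!%:R * \prod_(i <- s) x i) *: \prod_(i <- s) b i
  /\ (\sum_(i <- s) x i *: b i) ^+ (size s).+1 = 0.
Proof.
elim: s => [|i s [IHs IHs0]]; first by rewrite !big_nil expr0 expr1 mulr1 scale1r.
rewrite !big_cons /=; set A := \sum_(j <- s) _ in IHs IHs0 *.
have yy : x i *: b i * (x i *: b i) = 0 by rewrite -scalerAl -scalerAr b_sqr !scaler0.
have Ay : A * (x i *: b i) = x i *: b i * A.
  rewrite mulr_suml mulr_sumr; apply: eq_bigr => j _.
  by rewrite -!scalerAl -!scalerAr b_comm !scalerA mulrC.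
rewrite !exprDn_sqr0 //; split.
  rewrite IHs0 add0r IHs -scalerAl -scalerAr !scalerA; congr (_ *: _).
  by rewrite factS natrM; ring.
by rewrite exprS IHs0 !mulr0 add0r scaler0.
Qed.

End SquareZero.

(** * Comparison of coefficients and elementary symmetric polynomials *)

Lemma eq_powers_sum (R : realType) n (a c : nat -> R) :
  (forall t, \sum_(j < n) a j * t ^+ j = \sum_(j < n) c j * t ^+ j) ->
  forall j, (j < n)%N -> a j = c j.
Proof.
move=> ac j jn; apply/eqP; rewrite -subr_eq0; apply/eqP.
pose p := \poly_(k < n) (a k - c k).
have p0 : p = 0.
  (* The difference has size at most n and the n distinct roots 0, ..., n - 1. *)
  apply: (@roots_geq_poly_eq0 _ _ [seq k%:R | k <- iota 0 n]).
  - apply/allP => _ /mapP[k _ ->]; rewrite /root horner_poly.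
    under eq_bigr => i _ do rewrite mulrBl.
    by rewrite sumrB ac subrr.
  - by rewrite map_inj_uniq ?iota_uniq // => k l /eqP; rewrite eqr_nat => /eqP.
  - by rewrite size_map size_iota size_poly.
by have := coef_poly n (fun k => a k - c k) j; rewrite -/p p0 coef0 jn.
Qed.

Definition elem_sym (R : realType) n (x : 'I_n -> R) j : R :=
  \sum_(I : {set 'I_n} | #|I| == j) \prod_(k in I) x k.

Lemma prod1D_elem_sym (R : realType) n (x : 'I_n -> R) t :
  \prod_i (1 + t * x i) = \sum_(j < n.+1) elem_sym x j * t ^+ j.
Proof.
under eq_bigr => i _ do rewrite addrC.
(* The expanded product is a sum over subsets, grouped here by cardinality; a subset of ['I_n] has
   at most n elements, so [inord] never falls back to its default. *)
rewrite bigA_distr (partition_big (fun J : {set 'I_n} => inord #|J| : 'I_n.+1) predT) //=.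
apply: eq_bigr => j _; rewrite /elem_sym big_distrl /=.
have cardJ (J : {set 'I_n}) : (inord #|J| == j :> 'I_n.+1) = (#|J| == j).
  by rewrite -val_eqE /= inordK // ltnS -[X in (_ <= X)%N](card_ord n) max_card.
apply: eq_big => [J|J]; first by rewrite cardJ.
rewrite cardJ => /eqP <-; rewrite -big_mkcond big_split /=.
by rewrite prodr_const mulrC.
Qed.

(** * Nonvanishing of the top-degree product of a frame *)

Section ExteriorFrame.
Variables (R : realType) (m : nat).

(** The coefficient is a product of shuffle signs, one for each factor. *)
Lemma ext_basis_prod_neq0 (l : seq 'I_m) : uniq l ->
  (\prod_(a <- l) ext_basis R a) [set a in l]%SET != 0.
Proof.
elim: l => [_|a l IHl] /=.
  by rewrite big_nil ffunE; have -> : [set a in [::]]%SET = finset.set0 :> {set 'I_m};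
    [apply/setP => a; rewrite !inE | rewrite eqxx oner_eq0].
move=> /andP[al /IHl l0]; rewrite big_cons ext_basisM.
have -> : [set b in a :: l]%SET :\ a = [set b in l]%SET.
  by apply/setP => b; rewrite !inE; case: (b =P a) => // ->; rewrite (negbTE al).
by rewrite !inE eqxx mul1r mulf_neq0 ?shuffle_sign_neq0.
Qed.

(* Expanding the product of all e_a in the frame, every monomial is 0 or, up to
   sign, the product over the frame. *)
Lemma ext_frame_prod_neq0 (J : 'M[R]_m) (l : seq 'I_m) : J \in unitmx ->
  perm_eq l (index_enum 'I_m ) -> \prod_(b <- l) ext_vec (row b J) != 0.
Proof.
move=> Ju lm; apply/eqP => b0; pose v b := ext_vec (row b J).
have v_anti i j : v i * v j = - (v j * v i) by exact: ext_vec_anti.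
have v_sqr i : v i * v i = 0 by exact: ext_vec_sqr.
have vf0 (f : {ffun 'I_m -> 'I_m}) : \prod_a v (f a) = 0.
  rewrite -(big_map f predT v) /=.
  have [fu|] := boolP (uniq [seq f a | a <- index_enum 'I_m]); last exact: anti_prod_nuniq.
  (* A choice of indices without repetition only reorders the frame, whose product is assumed to be
     0. *)
  have fl : perm_eq l [seq f a | a <- index_enum 'I_m].
    have sub : {subset [seq f a | a <- index_enum 'I_m] <= index_enum 'I_m}.
      by move=> a _; rewrite mem_index_enum.
    have size_f : (size (index_enum 'I_m) <= size [seq f a | a <- index_enum 'I_m])%N.
      by rewrite size_map.
    have [_ ?] := uniq_min_size fu sub size_f.
    by rewrite (permPl lm) uniq_perm ?index_enum_uniq.
  by have [e ->] := anti_prod_perm v_anti fl; rewrite b0 mulr0.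
have := ext_basis_prod_neq0 (index_enum_uniq 'I_m); apply/negP; rewrite negbK /=.
have basisE a : ext_basis R a = \sum_b invmx J a b *: v b.
  transitivity (\sum_c (1%:M : 'M[R]_m) a c *: ext_basis R c).
    rewrite (bigD1 a) //= mxE eqxx scale1r big1 ?addr0 // => c ca.
    by rewrite mxE eq_sym (negbTE ca) scale0r.
  rewrite -(mulVmx Ju); under [RHS]eq_bigr => b _ do rewrite scaler_sumr.
  rewrite exchange_big; apply: eq_bigr => c _; rewrite mxE scaler_suml.
  by apply: eq_bigr => b _; rewrite scalerA !mxE.
under eq_bigr => a _ do rewrite basisE.
rewrite bigA_distr_bigA big1 ?ffunE // => f _.
by rewrite scaler_prod vf0 scaler0.
Qed.

End ExteriorFrame.

Lemma size_index_enum_ord n : size (index_enum 'I_n) = n.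
Proof. by rewrite -sum1_size sum1_card card_ord. Qed.

(** * The pencil of two bivectors that are diagonal in a common frame *)

Section PoissonPencil.
Variables (R : realType) (n : nat).
Implicit Types (J : 'M[R]_(n + n)) (x : 'rV[R]_n).

(** The bivector sum_i x_i e_i /\ e_(n+i), in the layout of real parts followed by imaginary
    parts. *)
Definition darboux_mx x : 'M[R]_(n + n) := block_mx 0 (diag_mx x) (- diag_mx x) 0.

Definition frame_wedge J (i : 'I_n) : ext R (n + n) :=
  ext_vec (row (lshift n i) J) * ext_vec (row (rshift n i) J).

Lemma darboux_mx_frame J x : J^T *m darboux_mx x *m J =
  \sum_i x 0 i *: ((row (lshift n i) J)^T *m row (rshift n i) J
                   - (row (rshift n i) J)^T *m row (lshift n i) J).
Proof.
rewrite -{1 2}[J]vsubmxK /darboux_mx tr_col_mx -mulmxA mul_block_col.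
rewrite mul_row_col !mul0mx add0r addr0 mulNmx mulmxN !mul_diag_mx.
apply/matrixP => a b; rewrite summxE !mxE -sumrN -big_split; apply: eq_bigr => i _ /=.
by rewrite !mxE !big_ord1 !mxE; ring.
Qed.

Lemma bivector_of_darboux J x :
  bivector_of (J^T *m darboux_mx x *m J) = \sum_i x 0 i *: frame_wedge J i.
Proof.
rewrite darboux_mx_frame bivector_of_sum; apply: eq_bigr => i _.
by rewrite bivector_ofZ bivector_of_wedge.
Qed.

(** A vector passing a product of two vectors changes sign twice. *)
Lemma frame_wedge_comm J i j :
  frame_wedge J i * frame_wedge J j = frame_wedge J j * frame_wedge J i.
Proof.
suff comm2 (a b c d : 'rV[R]_(n + n)) :
    ext_vec a * ext_vec b * (ext_vec c * ext_vec d) =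
    ext_vec c * ext_vec d * (ext_vec a * ext_vec b) by exact: comm2.
have pass u : ext_vec a * ext_vec b * ext_vec u = ext_vec u * (ext_vec a * ext_vec b).
  rewrite -mulrA (ext_vec_anti b) mulrN [ext_vec a * (_ * _)]mulrA (ext_vec_anti a).
  by rewrite mulNr opprK mulrA.
by rewrite mulrA pass -mulrA pass mulrA.
Qed.

Lemma frame_wedge_sqr J i : frame_wedge J i * frame_wedge J i = 0.
Proof.
rewrite /frame_wedge -mulrA [X in _ * X]mulrA [X in _ * (X * _)]ext_vec_anti.
by rewrite mulNr -mulrA ext_vec_sqr mulr0 oppr0 mulr0.
Qed.

(** Listing the rows of [J] in the pairs (i, n + i) is a reordering of the whole frame. *)
Lemma frame_wedge_prod_neq0 J : J \in unitmx -> \prod_i frame_wedge J i != 0.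
Proof.
move=> Ju.
have -> : \prod_i frame_wedge J i = \prod_(a <- flatten
    [seq [:: lshift n i; rshift n i] | i <- index_enum 'I_n]) ext_vec (row a J).
  rewrite big_flatten big_map; apply: eq_bigr => i _.
  by rewrite big_cons big_seq1.
set s := flatten _; apply: ext_frame_prod_neq0 Ju _.
have sub : {subset index_enum 'I_(n + n) <= s}.
  move=> a _; apply/flatten_mapP; case: (splitP a) => i ai; exists i;
    rewrite ?mem_index_enum // !inE; apply/orP; [left | right];
    by apply/eqP/val_inj; rewrite /= ai.
have size_s : (size s <= size (index_enum 'I_(n + n)))%N.
  rewrite size_index_enum_ord.
  rewrite size_flatten /shape -map_comp sumnE big_map (eq_bigr (fun=> 2%N)) // big_const_seq.
  rewrite count_predT iter_addn_0.
  by rewrite size_index_enum_ord mul2n addnn.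
have us : uniq s := leq_size_uniq (index_enum_uniq _) sub size_s.
apply: uniq_perm (index_enum_uniq _) _ => // a.
by rewrite mem_index_enum sub ?mem_index_enum.
Qed.

(* Coefficient of t^j in (sum_i (1 + t x_i) b_i)^n = n! prod_i (1 + t x_i) b_i. *)
Lemma pencil_elem_sym J x j : (j <= n)%N ->
  (\sum_i x 0 i *: frame_wedge J i) ^+ j * (\sum_i frame_wedge J i) ^+ (n - j) =
  (n`!%:R / 'C(n, j)%:R * elem_sym (x 0) j) *: \prod_i frame_wedge J i.
Proof.
set b := frame_wedge J; set X := \sum_i _ *: _; set Y := \sum_i b i => jn.
have bc : forall i k, b i * b k = b k * b i by exact: frame_wedge_comm.
have XY : GRing.comm Y X.
  rewrite /GRing.comm mulr_sumr mulr_suml; apply: eq_bigr => i _.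
  rewrite -scalerAr -scalerAl mulr_suml mulr_sumr; congr (_ *: _).
  by apply: eq_bigr => k _; rewrite bc.
have top (y : 'I_n -> R) : (\sum_i y i *: b i) ^+ n = (n`!%:R * \prod_i y i) *: \prod_i b i.
  have := (expr_sum_sqr0 bc (@frame_wedge_sqr J) y (index_enum 'I_n)).1.
  by rewrite size_index_enum_ord.
(* At a fixed coefficient [S] the two expansions are real polynomials in t and can be compared power
   by power. *)
apply/ffunP => S; rewrite ext_scaleE.
pose B := (\prod_i b i) S.
have E : 'C(n, j)%:R * (X ^+ j * Y ^+ (n - j)) S = n`!%:R * elem_sym (x 0) j * B.
  apply: (@eq_powers_sum R n.+1 (fun k => 'C(n, k)%:R * (X ^+ k * Y ^+ (n - k)) S)
    (fun k => n`!%:R * elem_sym (x 0) k * B)) => // t.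
  transitivity (((Y + t *: X) ^+ n) S).
    have YtX : GRing.comm Y (t *: X).
      by rewrite /GRing.comm -scalerAr XY scalerAl.
    rewrite (exprDn_comm _ YtX) sum_ffunE; apply: eq_bigr => k _.
    have natS (A : ext R (n + n)) l : (A *+ l) S = l%:R * A S.
      by rewrite -scaler_nat ext_scaleE.
    rewrite natS exprZn -scalerAr ext_scaleE.
    have -> : Y ^+ (n - k) * X ^+ k = X ^+ k * Y ^+ (n - k).
      by rewrite (commrX _ (commr_sym (commrX _ (commr_sym XY)))).
    by ring.
  have -> : Y + t *: X = \sum_i (1 + t * x 0 i) *: b i.
    rewrite scaler_sumr -big_split; apply: eq_bigr => i _ /=.
    by rewrite scalerA scalerDl scale1r.
  rewrite top ext_scaleE prod1D_elem_sym mulr_sumr mulr_suml; apply: eq_bigr => k _.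
  by rewrite -/B; ring.
have C0 : 'C(n, j)%:R != 0 :> R by rewrite pnatr_eq0 -lt0n bin_gt0.
by apply: (mulfI C0); rewrite E -/B; field.
Qed.

Lemma pencil_quotient J x (c d F : R) j : J \in unitmx -> c != 0 -> (j <= n)%N ->
  let ps := bivector_of (J^T *m darboux_mx (const_mx c) *m J) in
  let pinf := bivector_of (J^T *m darboux_mx (d *: x) *m J) in
  (forall S, F * wedge_pow ps n S =
     wedge (wedge_pow pinf j) (wedge_pow ps (n - j)) S) ->
  F = (d / c) ^+ j / 'C(n, j)%:R * elem_sym (x 0) j.
Proof.
move=> Ju c0 jn ps pinf FS.
set b := frame_wedge J; set X := \sum_i x 0 i *: b i; set Y := \sum_i b i.
have psE : ps = c *: Y :> ext R (n + n).
  rewrite /ps bivector_of_darboux scaler_sumr; apply: eq_bigr => i _.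
  by rewrite mxE.
have pinfE : pinf = d *: X :> ext R (n + n).
  rewrite /pinf bivector_of_darboux scaler_sumr; apply: eq_bigr => i _.
  by rewrite mxE scalerA.
have E : F *: (ps : ext R (n + n)) ^+ n =
    (pinf : ext R (n + n)) ^+ j * (ps : ext R (n + n)) ^+ (n - j).
  by apply/ffunP => S; rewrite ext_scaleE -!wedge_powE FS.
have := pencil_elem_sym J x jn; rewrite -/b -/X -/Y => XYE.
(* The case of index 0 evaluates the top power in the denominator of the quotient. *)
have := pencil_elem_sym J x (leq0n n); rewrite -/b -/X -/Y expr0 mul1r subn0 => YE.
have e0 : elem_sym (x 0) 0 = 1.
  rewrite /elem_sym (big_pred1 finset.set0) ?big_set0 // => I.
  by rewrite cards_eq0.
rewrite psE pinfE !exprZn -scalerAl -scalerAr XYE YE e0 bin0 !scalerA in E.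
move/eqP: E; rewrite -subr_eq0 -scalerBl scaler_eq0 (negbTE (frame_wedge_prod_neq0 Ju)).
rewrite orbF subr_eq0 => /eqP.
have n0 : n`!%:R != 0 :> R by rewrite pnatr_eq0 -lt0n fact_gt0.
have C0 : 'C(n, j)%:R != 0 :> R by rewrite pnatr_eq0 -lt0n bin_gt0.
rewrite -{1}(subnK jn) addnC exprD => E.
have cj k : c ^+ k != 0 by rewrite expf_neq0.
apply: (mulIf n0); apply: (mulIf (cj (n - j)%N)); apply: (mulIf (cj j)).
rewrite expr_div_n.
transitivity (F * (c ^+ j * c ^+ (n - j)) * (n`!%:R / 1 * 1)).
  by field.
by rewrite E; field; rewrite C0 cj.
Qed.

End PoissonPencil.

(** * Gelfand-Tsetlin coordinates *)

Section GelfandTsetlin.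
Variables (R : realType).
Local Notation C := R[i]%C.
Local Notation "z %:C" := (real_complex R z) : ring_scope.

Lemma sqabsE (z : C) : (sqabs z)%:C = z * z^*.
Proof. by rewrite /sqabs add_Re2_Im2 normCK. Qed.

Lemma sqabs_ge0 (z : C) : 0 <= sqabs z.
Proof. by rewrite /sqabs addr_ge0 ?sqr_ge0. Qed.

Lemma sqabs_eq0 (z : C) : (sqabs z == 0) = (z == 0).
Proof. by rewrite -(inj_eq (@complexI R)) sqabsE mulf_eq0 conjC_eq0 orbb. Qed.

Lemma sqabsM (y z : C) : sqabs (y * z) = sqabs y * sqabs z.
Proof. by apply: (@complexI R); rewrite rmorphM /= !sqabsE rmorphM mulrACA. Qed.

Lemma sqabs_real (x : R) : sqabs x%:C = x ^+ 2.
Proof. by rewrite /sqabs /= expr0n addr0. Qed.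

(** With a the claimed value, M^2 = i a M, so only 0 and i a can be eigenvalues. If a is nonzero, i
    a does occur, with eigenvector the conjugate transpose of v. As a >= 0, it comes first in
    decreasing order. *)
Lemma imaginary_spectrum_rank1 m (lambda : R) (v : 'cV[C]_m) : 0 <= lambda -> (0 < m)%N ->
  nth 0 (imaginary_spectrum (('i * lambda%:C) *: (v *m (map_mx Num.conj v)^T))) 0
  = lambda * \sum_i sqabs (v i 0).
Proof.
move=> l0 m0; set vs := _^T; set M := _ *: _; set a := RHS.
have a0 : 0 <= a by rewrite mulr_ge0 ?sumr_ge0 // => i _; exact: sqabs_ge0.
have vv : ('i * lambda%:C) *: (vs *m v) = ('i * a%:C)%:M.
  apply/matrixP => i j; rewrite !ord1 !mxE eqxx mulr1n /a rmorphM rmorph_sum /= -mulrA.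
  by congr (_ * (_ * _)); apply: eq_bigr => k _; rewrite !mxE sqabsE mulrC.
have M2 : M *m M = ('i * a%:C) *: M.
  rewrite {1 2}/M -scalemxAl -scalemxAr -mulmxA (mulmxA vs).
  rewrite scalemxAl scalemxAr [X in _ *m X]scalemxAl vv mul_scalar_mx.
  by rewrite -scalemxAr -scalemxAl.
have rootM x : root (char_poly M) x -> x = 0 \/ x = 'i * a%:C.
  rewrite -eigenvalue_root_char => /eigenvalueP[u uM u0].
  have : (x * x - 'i * a%:C * x) *: u = 0.
    rewrite scalerBl.
    have -> : (x * x) *: u = ('i * a%:C * x) *: u.
      by rewrite -scalerA -{1}uM scalemxAl -uM -mulmxA M2 -scalemxAr uM scalerA.
    by rewrite subrr.
  move/eqP; rewrite scaler_eq0 (negbTE u0) orbF -mulrBl mulf_eq0 subr_eq0.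
  by case/orP => /eqP ->; [right | left].
have rootMa : a != 0 -> root (char_poly M) ('i * a%:C).
  move=> an0; rewrite -eigenvalue_root_char; apply/eigenvalueP; exists vs.
    by rewrite /M -scalemxAr mulmxA scalemxAl vv mul_scalar_mx.
  apply: contraNneq an0 => vs0; move: vv; rewrite vs0 mul0mx scaler0.
  move=> /matrixP/(_ 0 0); rewrite !mxE eqxx mulr1n => /esym/eqP.
  by rewrite mulf_eq0 (negbTE (neq0Ci _)) /= fmorph_eq0.
(* The default of [xget] is ruled out: the sorted imaginary parts of the roots of the characteristic
   polynomial form an admissible list. *)
rewrite /imaginary_spectrum; case: xgetP => [s _ [s_sorted sE]|no_s]; last first.
  exfalso.
  have [rs rsE] := closed_field_poly_normal (char_poly M).
  move: rsE; rewrite (monicP (char_poly_monic M)) scale1r => rsE.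
  pose s := sort >=%R [seq complex.Im x | x <- rs].
  apply: (no_s s); split.
    by apply: sort_sorted => x y; rewrite /= le_total.
  rewrite rsE (perm_big [seq complex.Im x | x <- rs]) ?perm_sort //= big_map.
  rewrite big_seq [RHS]big_seq; apply: eq_bigr => x xrs; congr ('X - _%:P).
  have : root (char_poly M) x by rewrite rsE root_prod_XsubC.
  case/rootM => ->; first by rewrite mulr0.
  have -> // : complex.Im ('i * a%:C) = a by rewrite -complexiE mulrC ImiRe.
have s_mem x : x \in s -> x = 0 \/ x = a.
  move=> xs; have : root (char_poly M) ('i * x%:C).
    rewrite sE -(big_map (fun x : R => 'i * x%:C) predT (fun y => 'X - y%:P)).
    by rewrite root_prod_XsubC; apply: (map_f (fun x : R => 'i * x%:C)).
  have iI (y z : R) : 'i * y%:C = 'i * z%:C -> y = z.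
    by move=> /(mulfI (neq0Ci _))/(@complexI R).
  case/rootM => [/eqP|/iI]; last by right.
  by rewrite mulf_eq0 (negbTE (neq0Ci _)) /= fmorph_eq0 => /eqP ->; left.
have s_size : size s = m.
  have := size_char_poly M; rewrite sE.
  rewrite -(big_map (fun x : R => 'i * x%:C) predT (fun y => 'X - y%:P)).
  by rewrite size_prod_XsubC size_map => -[].
case: s => [|x s] in s_sorted sE s_mem s_size *; first by rewrite -s_size in m0.
have [//|x_a] := s_mem x (mem_head _ _); last by rewrite x_a.
move=> /= x0; rewrite x0; have [->//|an0] := eqVneq a 0.
(* With head 0 and a > 0, the eigenvalue i a would sit further down a decreasing list. *)
have : a \in x :: s.
  move: (rootMa an0); rewrite sE.
  rewrite -(big_map (fun x : R => 'i * x%:C) predT (fun y => 'X - y%:P)).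
  rewrite root_prod_XsubC => /mapP[b bs].
  by move=> /(mulfI (neq0Ci _))/(@complexI R) ->.
have tr : transitive (>=%R : rel R) by move=> y z t yz zt; apply: le_trans yz.
move: s_sorted; rewrite /= (path_sortedE tr) => /andP[/allP xs _].
rewrite inE => /orP[/eqP ax|/xs]; first by rewrite ax.
by rewrite x0 => ale; apply/eqP; rewrite eq_le a0.
Qed.

(** For unitary A, the orbit matrix is i lambda v v^*, with v the first column of A; a corner
    truncates v to its first n - k entries and keeps this rank-one shape. *)
Lemma gt_coordE n (lambda : R) (A : 'M[C]_n.+1) (k : 'I_n) :
  0 <= lambda -> A \is unitarymx ->
  gt_coord lambda A k 0 = lambda * \sum_(i < n.+1 | (i < n - k)%N) sqabs (A i ord0).
Proof.
move=> l0 Au; rewrite /gt_coord.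
pose f := widen_ord (corner_size k); pose v := rowsub f (col ord0 A).
have -> : corner k (orbit_mx lambda A) =
    ('i * lambda%:C) *: (v *m (map_mx Num.conj v)^T).
  apply/matrixP => i j; rewrite /orbit_mx invmx_unitary // -scalemxAr -scalemxAl !mxE.
  rewrite big_ord1 (bigD1 ord0) //= big1 ?addr0; last first.
    move=> l l0'; rewrite mxE (bigD1 ord0) //= big1 ?addr0; last first.
      by move=> p p0; rewrite !mxE (negbTE p0) mulr0.
    by rewrite !mxE (negbTE l0') andbF mulr0 mul0r.
  rewrite !mxE (bigD1 ord0) //= big1 ?addr0; last first.
    by move=> p p0; rewrite !mxE (negbTE p0) mulr0.
  by rewrite !mxE !eqxx mulr1.
rewrite imaginary_spectrum_rank1 //; last by rewrite subn_gt0.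
congr (_ * _); rewrite (big_ord_narrow (corner_size k)); apply: eq_bigr => i _.
by rewrite !mxE.
Qed.

Lemma sqabs_unitary_col n (A : 'M[C]_n.+1) j :
  A \is unitarymx -> \sum_i sqabs (A i j) = 1.
Proof.
move=> Au; apply: (@complexI R); rewrite rmorph_sum rmorph1 /=.
have : A^T \is unitarymx by rewrite trmx_unitary.
move=> /unitarymxP/matrixP/(_ j j); rewrite !mxE eqxx mulr1n => <-.
by apply: eq_bigr => i _; rewrite sqabsE !mxE.
Qed.

End GelfandTsetlin.

(** * Differentials in the affine charts *)

Section DirectionalDerivatives.
Variables (R : realType) (m : nat).
Implicit Types (f g : 'rV[R]_m -> R) (w h : 'rV[R]_m) (L : 'rV[R]_m -> R).
Local Notation C := R[i]%C.

(** Differentiability is bundled with a formula for all directional derivatives, so that the chart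
    maps can be differentiated rule by rule. *)
Definition has_diff f w L := differentiable f w /\ forall h, 'D_h f w = L h.

Lemma has_diff_eq f w L L' : has_diff f w L -> L =1 L' -> has_diff f w L'.
Proof. by move=> [df Lf] LL'; split=> // h; rewrite Lf. Qed.

Lemma has_diff_cst a w : has_diff (fun=> a) w (fun=> 0).
Proof. by split=> [|h]; [exact: differentiable_cst | exact: derive_cst]. Qed.

Lemma has_diff_coord a w : has_diff (fun w => w 0 a) w (fun h => h 0 a).
Proof.
split=> [|h]; first exact: differentiable_coord.
have := @derive_mx R _ _ _ id w h (@derivable_id R _ w h).
by rewrite derive_id => /matrixP/(_ 0 a); rewrite mxE => ->.
Qed.

Lemma has_diffD f g w L M : has_diff f w L -> has_diff g w M ->
  has_diff (fun w => f w + g w) w (fun h => L h + M h).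
Proof.
move=> [df Lf] [dg Mg]; split=> [|h]; first exact: differentiableD.
by rewrite deriveD ?Lf ?Mg //; exact: diff_derivable.
Qed.

Lemma has_diffM f g w L M : has_diff f w L -> has_diff g w M ->
  has_diff (fun w => f w * g w) w (fun h => f w * M h + g w * L h).
Proof.
move=> [df Lf] [dg Mg]; split=> [|h]; first exact: differentiableM.
by rewrite deriveM ?Lf ?Mg //; exact: diff_derivable.
Qed.

Lemma has_diffV f w L : f w != 0 -> has_diff f w L ->
  has_diff (fun w => (f w)^-1) w (fun h => - L h / f w ^+ 2).
Proof.
move=> fw0 [df Lf]; split=> [|h]; first exact: differentiableV.
rewrite deriveV ?Lf //; last exact: diff_derivable.
by rewrite /GRing.scale /=; field.
Qed.

Lemma has_diffN f w L : has_diff f w L ->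
  has_diff (fun w => - f w) w (fun h => - L h).
Proof.
move=> [df Lf]; split=> [|h]; first exact: differentiableN.
by rewrite deriveN ?Lf //; exact: diff_derivable.
Qed.

Lemma has_diff_sum (I : Type) (s : seq I) (P : pred I) (f L : I -> 'rV[R]_m -> R) w :
  (forall i, P i -> has_diff (f i) w (L i)) ->
  has_diff (fun w => \sum_(i <- s | P i) f i w) w (fun h => \sum_(i <- s | P i) L i h).
Proof.
move=> fL; elim: s => [|i s IHs].
  have -> : (fun w => \sum_(i <- [::] | P i) f i w) = fun=> 0.
    by apply/funext => v; rewrite big_nil.
  by apply: has_diff_eq (has_diff_cst _ _) _ => h; rewrite big_nil.
case Pi: (P i).
  have -> : (fun w => \sum_(i <- i :: s | P i) f i w) =
      fun w => f i w + \sum_(i <- s | P i) f i w.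
    by apply/funext => v; rewrite big_cons Pi.
  by apply: has_diff_eq (has_diffD (fL i Pi) IHs) _ => h; rewrite big_cons Pi.
have -> : (fun w => \sum_(i <- i :: s | P i) f i w) =
    fun w => \sum_(i <- s | P i) f i w.
  by apply/funext => v; rewrite big_cons Pi.
by apply: has_diff_eq IHs _ => h; rewrite big_cons Pi.
Qed.

Lemma has_diff_sqrt f w L : 0 < f w -> has_diff f w L ->
  has_diff (fun w => Num.sqrt (f w)) w (fun h => L h / (2 * Num.sqrt (f w))).
Proof.
move=> fw0 [df Lf].
have ds := is_derive1_sqrt fw0.
have dsqrt : differentiable (Num.sqrt : R -> R) (f w) by apply/derivable1_diffP; case: ds.
split=> [|h]; first exact: (differentiable_comp df dsqrt).
rewrite deriveE; last exact: (differentiable_comp df dsqrt).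
rewrite (diff_comp df dsqrt) /= -(deriveE _ df) Lf diff1E // derive1E.
by rewrite derive_sqrt.
Qed.

(** Only real differentiability is meant, and [L] need not be complex linear: the coordinates y_i
    are not holomorphic. *)
Definition has_cdiff (F : 'rV[R]_m -> C) w (L : 'rV[R]_m -> C) :=
  has_diff (fun w => complex.Re (F w)) w (fun h => complex.Re (L h)) /\
  has_diff (fun w => complex.Im (F w)) w (fun h => complex.Im (L h)).

Implicit Types (F G M N : 'rV[R]_m -> C).

Lemma has_cdiff_eq F w M N : has_cdiff F w M -> M =1 N -> has_cdiff F w N.
Proof. by move=> [Fr Fi] MN; split; [apply: has_diff_eq Fr _ | apply: has_diff_eq Fi _];
  move=> h; rewrite MN. Qed.

Lemma has_cdiff_cst (c : C) w : has_cdiff (fun=> c) w (fun=> 0).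
Proof. by split; exact: has_diff_cst. Qed.

Lemma has_cdiff_real f w L : has_diff f w L ->
  has_cdiff (fun w => (f w)%:C%C) w (fun h => (L h)%:C%C).
Proof. by split=> //=; exact: has_diff_cst. Qed.

Lemma Re_addc (x y : C) : complex.Re (x + y) = complex.Re x + complex.Re y.
Proof. by case: x; case: y. Qed.

Lemma Im_addc (x y : C) : complex.Im (x + y) = complex.Im x + complex.Im y.
Proof. by case: x; case: y. Qed.

Lemma Re_sumc (I : Type) (s : seq I) (P : pred I) (f : I -> C) :
  complex.Re (\sum_(i <- s | P i) f i) = \sum_(i <- s | P i) complex.Re (f i).
Proof. by apply: big_morph => // x y; exact: Re_addc. Qed.

Lemma Im_sumc (I : Type) (s : seq I) (P : pred I) (f : I -> C) :
  complex.Im (\sum_(i <- s | P i) f i) = \sum_(i <- s | P i) complex.Im (f i).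
Proof. by apply: big_morph => // x y; exact: Im_addc. Qed.

Lemma has_cdiffD F G w M N : has_cdiff F w M -> has_cdiff G w N ->
  has_cdiff (fun w => F w + G w) w (fun h => M h + N h).
Proof.
move=> [Fr Fi] [Gr Gi]; split.
  have -> : (fun w => complex.Re (F w + G w)) =
      (fun w => complex.Re (F w) + complex.Re (G w)) by apply/funext => v; rewrite Re_addc.
  by apply: has_diff_eq (has_diffD Fr Gr) _ => h; rewrite Re_addc.
have -> : (fun w => complex.Im (F w + G w)) =
    (fun w => complex.Im (F w) + complex.Im (G w)) by apply/funext => v; rewrite Im_addc.
by apply: has_diff_eq (has_diffD Fi Gi) _ => h; rewrite Im_addc.
Qed.

Lemma Re_mulc (x y : C) : complex.Re (x * y) =
  complex.Re x * complex.Re y - complex.Im x * complex.Im y.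
Proof. by case: x; case: y. Qed.

Lemma Im_mulc (x y : C) : complex.Im (x * y) =
  complex.Re x * complex.Im y + complex.Im x * complex.Re y.
Proof. by case: x; case: y. Qed.

Lemma has_cdiffM F G w M N : has_cdiff F w M -> has_cdiff G w N ->
  has_cdiff (fun w => F w * G w) w (fun h => F w * N h + G w * M h).
Proof.
move=> [Fr Fi] [Gr Gi]; split.
  have -> : (fun w => complex.Re (F w * G w)) = (fun w =>
      complex.Re (F w) * complex.Re (G w) + - (complex.Im (F w) * complex.Im (G w))).
    by apply/funext => v; rewrite Re_mulc.
  apply: has_diff_eq (has_diffD (has_diffM Fr Gr) (has_diffN (has_diffM Fi Gi))) _ => h.
  by rewrite Re_addc !Re_mulc; ring.
have -> : (fun w => complex.Im (F w * G w)) = (fun w =>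
    complex.Re (F w) * complex.Im (G w) + complex.Im (F w) * complex.Re (G w)).
  by apply/funext => v; rewrite Im_mulc.
apply: has_diff_eq (has_diffD (has_diffM Fr Gi) (has_diffM Fi Gr)) _ => h.
by rewrite Im_addc !Im_mulc; ring.
Qed.

Lemma Re_oppc (x : C) : complex.Re (- x) = - complex.Re x.
Proof. by case: x. Qed.

Lemma Im_oppc (x : C) : complex.Im (- x) = - complex.Im x.
Proof. by case: x. Qed.

Lemma Re_conjc (x : C) : complex.Re (x^*) = complex.Re x.
Proof. by case: x. Qed.

Lemma Im_conjc (x : C) : complex.Im (x^*) = - complex.Im x.
Proof. by case: x. Qed.

Lemma has_cdiffV F w M : F w != 0 -> has_cdiff F w M ->
  has_cdiff (fun w => (F w)^-1) w (fun h => - M h / F w ^+ 2).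
Proof.
move=> Fw0 [Fr Fi].
have s0 : sqabs (F w) != 0 by rewrite sqabs_eq0.
have sd : has_diff (fun w => sqabs (F w)) w (fun h => 2 *
    (complex.Re (F w) * complex.Re (M h) + complex.Im (F w) * complex.Im (M h))).
  have -> : (fun w => sqabs (F w)) = (fun w => complex.Re (F w) * complex.Re (F w)
      + complex.Im (F w) * complex.Im (F w)).
    by apply/funext => v; rewrite /sqabs; ring.
  by apply: has_diff_eq (has_diffD (has_diffM Fr Fr) (has_diffM Fi Fi)) _ => h; ring.
have sVd := has_diffV s0 sd.
have invE (z : C) : z^-1 = (complex.Re z * (sqabs z)^-1 +i* - (complex.Im z * (sqabs z)^-1))%C.
  by case: z.
(* Writing 1 / z^2 as conj(z)^2 / |z|^4 leaves only real denominators, so that real and imaginary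
   parts can be separated. *)
have cE (h : 'rV[R]_m) : - M h / F w ^+ 2 =
    (- M h * (F w)^* * (F w)^*) * (((sqabs (F w))^-1) ^+ 2)%:C%C.
  have E : (sqabs (F w))%:C%C != 0 :> C by rewrite fmorph_eq0.
  rewrite rmorphXn /= fmorphV /=.
  apply: (mulIf (expf_neq0 2 E)).
  rewrite -[RHS]mulrA -[_^-1 ^+ 2 * _]exprMn mulVf // expr1n mulr1 sqabsE.
  by field.
split.
  have -> : (fun w => complex.Re (F w)^-1) =
      (fun w => complex.Re (F w) * (sqabs (F w))^-1).
    by apply/funext => v; rewrite invE.
  apply: has_diff_eq (has_diffM Fr sVd) _ => h; rewrite cE.
  rewrite 3!Re_mulc !Im_mulc Re_oppc Im_oppc Re_conjc Im_conjc /=; move: s0; rewrite /sqabs => s0.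
  by field.
have -> : (fun w => complex.Im (F w)^-1) =
    (fun w => - (complex.Im (F w) * (sqabs (F w))^-1)).
  by apply/funext => v; rewrite invE.
apply: has_diff_eq (has_diffN (has_diffM Fi sVd)) _ => h; rewrite cE.
rewrite !Im_mulc !Re_mulc Re_oppc Im_oppc Re_conjc Im_conjc /=; move: s0; rewrite /sqabs => s0.
by field.
Qed.

Lemma has_cdiff_sum (I : Type) (s : seq I) (P : pred I) (F M : I -> 'rV[R]_m -> C) w :
  (forall i, P i -> has_cdiff (F i) w (M i)) ->
  has_cdiff (fun w => \sum_(i <- s | P i) F i w) w (fun h => \sum_(i <- s | P i) M i h).
Proof.
move=> FM; split.
  under eq_fun do rewrite Re_sumc; apply: has_diff_eq (has_diff_sum _ _) _.
    by move=> i Pi; exact: (FM i Pi).1.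
  by move=> h; rewrite Re_sumc.
under eq_fun do rewrite Im_sumc; apply: has_diff_eq (has_diff_sum _ _) _.
  by move=> i Pi; exact: (FM i Pi).2.
by move=> h; rewrite Im_sumc.
Qed.

Lemma jacobian_coord k (F : 'rV[R]_m -> 'rV[R]_k) w (M : 'I_k -> 'rV[R]_m -> R) :
  (forall b, has_diff (fun w => F w 0 b) w (M b)) ->
  forall h, h *m jacobian F w = \row_b M b h.
Proof.
move=> FM h; have dF : differentiable F w.
  have -> : F = \sum_b (fun w => F w 0 b *: delta_mx 0 b : 'rV_k).
    by apply/funext => v; rewrite fct_sumE [LHS]row_sum_delta.
  by apply: differentiable_sum => b; apply: differentiableZl; exact: (FM b).1.
rewrite -deriveEjacobian // derive_mx; last exact: diff_derivable.
by apply/rowP => b; rewrite !mxE (FM b).2.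
Qed.

End DirectionalDerivatives.

Lemma jacobian_to_real (R : realType) m n (F : 'rV[R]_m -> 'rV[R[i]%C]_n) w
    (M : 'I_n -> 'rV[R]_m -> R[i]%C) :
  (forall i, has_cdiff (fun w => F w 0 i) w (M i)) ->
  forall h, h *m jacobian (fun w => to_real (F w)) w = to_real (\row_i M i h).
Proof.
move=> FM h.
rewrite (jacobian_coord (M := fun b h => to_real (\row_i M i h) 0 b)).
  by apply/rowP => b; rewrite mxE.
move=> b; case: (splitP b) => i bi.
  have -> : b = lshift n i by apply: val_inj.
  have [H _] := FM i; move: H; congr has_diff; apply/funext => v.
    by rewrite /to_real row_mxEl mxE.
  by rewrite /to_real row_mxEl !mxE.
have -> : b = rshift n i by apply: val_inj.
have [_ H] := FM i; move: H; congr has_diff; apply/funext => v.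
  by rewrite /to_real row_mxEr mxE.
by rewrite /to_real row_mxEr !mxE.
Qed.

Section ChartCalculus.
Variables (R : realType) (n : nat).
Local Notation C := R[i]%C.
Implicit Types (w h k : 'rV[R]_(n + n)).

Lemma to_complexK : cancel (@to_complex R n) (@to_real R n).
Proof.
move=> w; rewrite /to_real -[RHS]hsubmxK; congr row_mx; apply/rowP => i;
  by rewrite !mxE.
Qed.

Lemma to_realK : cancel (@to_real R n) (@to_complex R n).
Proof.
move=> z; apply/rowP => i; rewrite mxE /to_real row_mxEl row_mxEr !mxE.
by case: (z 0 i).
Qed.

Lemma has_cdiff_to_complex w i :
  has_cdiff (fun w => to_complex w 0 i) w (fun h => to_complex h 0 i).
Proof.
have E (v : 'rV[R]_(n + n)) : to_complex v 0 i = (v 0 (lshift n i) +i* v 0 (rshift n i))%C.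
  by rewrite mxE.
by split; [move: (has_diff_coord (lshift n i) w) | move: (has_diff_coord (rshift n i) w)];
  congr has_diff; apply/funext => v; rewrite E.
Qed.

Lemma homog_lift w (j : 'I_n) : homog ord0 w 0 (lift ord0 j) = to_complex w 0 j.
Proof. by rewrite mxE liftK. Qed.

Lemma homog_ord0 w : homog ord0 w 0 ord0 = 1.
Proof. by rewrite mxE unlift_none. Qed.

Lemma homog_mulE w (A : 'M[C]_n.+1) i :
  (homog ord0 w *m A) 0 i = A ord0 i + \sum_j to_complex w 0 j * A (lift ord0 j) i.
Proof.
rewrite mxE big_ord_recl homog_ord0 mul1r; congr (_ + _).
by apply: eq_bigr => j _; rewrite homog_lift.
Qed.

Lemma to_real_mulmx_real h (V : 'M[R]_n) :
  to_real (to_complex h *m map_mx (real_complex R) V) = h *m block_mx V 0 0 V.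
Proof.
rewrite -{2}[h]hsubmxK mul_row_block !mulmx0 addr0 add0r /to_real.
congr row_mx; apply/rowP => j; rewrite !mxE ?Re_sumc ?Im_sumc; apply: eq_bigr => i _.
  by rewrite Re_mulc !mxE /= mulr0 subr0.
by rewrite Im_mulc !mxE /= mulr0 add0r.
Qed.

(* Transposed, since tangent vectors are rows acted on from the right. *)
Definition minor0 (g : 'M[C]_n.+1) : 'M[C]_n :=
  \matrix_(l, j) g (lift ord0 j) (lift ord0 l).

(** At a point sent to the origin the numerators Z_j vanish, so the derivative of Z_j / Z_0 reduces
    to dZ_j / rho. *)
Lemma act_to_origin (g : 'M[C]_n.+1) w (rho : C) : rho != 0 ->
  homog ord0 w *m g^T = rho *: delta_mx 0 ord0 ->
  [/\ act_dom g ord0 ord0 w, act g ord0 ord0 w = 0 &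
   forall h, h *m jacobian (act g ord0 ord0) w =
     to_real (rho^-1 *: (to_complex h *m minor0 g))].
Proof.
move=> rho0 gw.
have Z0 : (homog ord0 w *m g^T) 0 ord0 = rho by rewrite gw !mxE !eqxx mulr1.
have Zl j : (homog ord0 w *m g^T) 0 (lift ord0 j) = 0.
  by rewrite gw !mxE eqxx mulr0.
split.
- by rewrite /act_dom Z0.
- rewrite /act /chart.
  have -> : \row_j ((homog ord0 w *m g^T) 0 (lift ord0 j) /
      (homog ord0 w *m g^T) 0 ord0) = 0.
    by apply/rowP => j; rewrite mxE Zl mul0r mxE.
  by rewrite -[RHS]to_complexK; congr to_real; apply/rowP => i; rewrite !mxE.
move=> h.
have dZ i : has_cdiff (fun w => (homog ord0 w *m g^T) 0 i) w
    (fun h => \sum_j to_complex h 0 j * g i (lift ord0 j)).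
  have -> : (fun w => (homog ord0 w *m g^T) 0 i) = fun w =>
      g i ord0 + \sum_j to_complex w 0 j * g i (lift ord0 j).
    apply/funext => v; rewrite homog_mulE mxE; congr (_ + _).
    by apply: eq_bigr => j _; rewrite [g^T _ _]mxE.
  have dt (j : 'I_n) : has_cdiff (fun w => to_complex w 0 j * g i (lift ord0 j)) w
      (fun h => to_complex h 0 j * g i (lift ord0 j)).
    apply: has_cdiff_eq (has_cdiffM (has_cdiff_to_complex _ _) (has_cdiff_cst _ _)) _.
    by move=> v; rewrite mulr0 add0r mulrC.
  apply: has_cdiff_eq (has_cdiffD (has_cdiff_cst _ _) (has_cdiff_sum _ (fun j _ => dt j))) _.
  by move=> v; rewrite add0r.
have Z0' : (homog ord0 w *m g^T) 0 ord0 != 0 by rewrite Z0.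
rewrite /act /chart (jacobian_to_real (M := fun j h =>
    rho^-1 * \sum_l to_complex h 0 l * g (lift ord0 j) (lift ord0 l))).
  congr to_real; apply/rowP => j; rewrite !mxE; congr (_ * _).
  by apply: eq_bigr => l _; rewrite !mxE.
move=> j; under eq_fun do rewrite mxE.
apply: has_cdiff_eq (has_cdiffM (dZ _) (has_cdiffV Z0' (dZ _))) _ => v.
by rewrite Zl mul0r add0r Z0.
Qed.

End ChartCalculus.

(** * Invariant 2-forms *)

Section InvariantForm.
Variables (R : realType) (n : nat).
Local Notation C := R[i]%C.
Implicit Types (w h k : 'rV[R]_(n + n)) (om : tensor_field R n).

(* Sign changes kill the off-diagonal entries, transpositions equate the
   diagonal ones. *)
Lemma scalar_mx_orthogonal (X : 'M[R]_n) :
  (forall V : 'M[R]_n, V *m V^T = 1%:M -> V *m X *m V^T = X) ->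
  exists a, X = a%:M.
Proof.
case: n X => [|p] X VX; first by exists 0; apply/matrixP => -[].
have X_diag i j : i != j -> X i j = 0.
  move=> ij; pose V : 'M[R]_p.+1 := diag_mx (\row_k (-1) ^+ (k == i)).
  have VVT : V *m V^T = 1%:M.
    rewrite tr_diag_mx mulmx_diag -diag_const_mx; congr diag_mx; apply/rowP => k.
    by rewrite !mxE -exprD addnn -mul2n exprM sqrrN expr1n expr1n.
  have /matrixP/(_ i j) := VX V VVT.
  rewrite tr_diag_mx mul_mx_diag mul_diag_mx !mxE eqxx eq_sym (negbTE ij) expr1 expr0.
  by move=> /eqP; rewrite mulr1 mulN1r eq_sym -addr_eq0 -mulr2n mulrn_eq0 /= => /eqP.
exists (X ord0 ord0); apply/matrixP => i j; rewrite mxE.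
have [<-|/X_diag//] := eqVneq i j; rewrite mulr1n.
have VVT : perm_mx (tperm ord0 i) *m (perm_mx (tperm ord0 i))^T = 1%:M :> 'M[R]_p.+1.
  by rewrite tr_perm_mx -perm_mxM mulgV perm_mx1.
have /matrixP/(_ ord0 ord0) := VX _ VVT.
by rewrite tr_perm_mx -row_permE -col_permE !mxE tpermL.
Qed.

(** An orthogonal V gives the unitary diag(1, V^T), which fixes the origin and acts on its tangent
    space as diag(V, V). Hence every n x n block of the form is scalar, and skewness kills the
    diagonal blocks. *)
Lemma invariant_form_origin om : unitary_invariant om ->
  (om ord0 0)^T = - om ord0 0 ->
  exists kappa : R, om ord0 0 = block_mx 0 kappa%:M (- kappa%:M) 0.
Proof.
move=> om_inv om_skew.
have inv (V : 'M[R]_n) : V *m V^T = 1%:M ->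
    block_mx V 0 0 V *m om ord0 0 *m (block_mx V 0 0 V)^T = om ord0 0.
  move=> VV; pose g : 'M[C]_(1 + n) := block_mx 1%:M 0 0 (map_mx (real_complex R) V^T).
  have gu : g \is unitarymx.
    apply/unitarymxP; rewrite /g tr_block_mx map_block_mx mulmx_block.
    rewrite !(trmx0, map_mx0, trmx1, map_mx1, mulmx0, mul0mx, mulmx1, addr0, add0r).
    have -> : map_mx (real_complex R) V^T *m map_mx Num.conj (map_mx (real_complex R) V^T)^T
        = 1%:M.
      have -> : map_mx Num.conj (map_mx (real_complex R) V^T)^T = map_mx (real_complex R) V.
        by apply/matrixP => i j; rewrite !mxE; exact: conjc_real.
      by rewrite -map_mxM (mulmx1C VV) map_mx1.
    by rewrite -scalar_mx_block.
  have g0 : homog ord0 0 *m g^T = 1 *: delta_mx 0 ord0 :> 'rV[C]_n.+1.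
    have -> : homog ord0 0 = delta_mx 0 ord0 :> 'rV[C]_n.+1.
      apply/rowP => i; case: (unliftP ord0 i) => [j|] ->.
        by rewrite homog_lift !mxE.
      by rewrite homog_ord0 !mxE !eqxx.
    rewrite -rowE scale1r /g tr_block_mx !trmx0 trmx1; apply/rowP => i.
    have l0 : ord0 = lshift n (@ord0 0) :> 'I_(1 + n) by exact: val_inj.
    case: (unliftP ord0 i) => [j|] ->.
      rewrite -(@rshift1 n j) l0 [LHS]mxE.
      by apply: etrans (block_mxEur _ _ _ _ _ _) _; rewrite !mxE.
    by rewrite l0 [LHS]mxE; apply: etrans (block_mxEul _ _ _ _ _ _) _; rewrite !mxE.
  have [dom act0 J] := act_to_origin (oner_neq0 _) g0.
  have := om_inv g gu ord0 ord0 0 dom.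
  rewrite act0 /pullback.
  suff -> : jacobian (act g ord0 ord0) 0 = block_mx V 0 0 V by [].
  apply/row_matrixP => a; rewrite !rowE J invr1 scale1r.
  set e := delta_mx 0 a.
  have -> : minor0 g = map_mx (real_complex R) V.
    apply/matrixP => l j; rewrite mxE -(@rshift1 n j) -(@rshift1 n l) /g.
    by apply: etrans (block_mxEdr _ _ _ _ _ _) _; rewrite !mxE.
  rewrite to_real_mulmx_real.
  by [].
have blocks (V : 'M[R]_n) : V *m V^T = 1%:M ->
    [/\ V *m ulsubmx (om ord0 0) *m V^T = ulsubmx (om ord0 0),
        V *m ursubmx (om ord0 0) *m V^T = ursubmx (om ord0 0) &
        V *m drsubmx (om ord0 0) *m V^T = drsubmx (om ord0 0)].
  move=> /inv; rewrite -{1 2}[om ord0 0]submxK tr_block_mx !trmx0 !mulmx_block.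
  rewrite !(mulmx0, mul0mx, addr0, add0r) => /eq_block_mx.
  by case.
have [a ulE] := scalar_mx_orthogonal (fun V VV => let: And3 p _ _ := blocks V VV in p).
have [b urE] := scalar_mx_orthogonal (fun V VV => let: And3 _ p _ := blocks V VV in p).
have [d drE] := scalar_mx_orthogonal (fun V VV => let: And3 _ _ p := blocks V VV in p).
have skew0 (c : R) : c%:M = - c%:M :> 'M[R]_n -> c%:M = 0 :> 'M[R]_n.
  by move/eqP; rewrite -addr_eq0 -mulr2n -scaler_nat scaler_eq0 pnatr_eq0 => /eqP.
exists b; move: om_skew; rewrite -[om ord0 0]submxK tr_block_mx opp_block_mx ulE urE drE.
rewrite !tr_scalar_mx => /eq_block_mx[/skew0-> _ -> /skew0->].
by rewrite opprK.
Qed.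

Definition herm (u v : 'rV[C]_n) : C := (u *m (map_mx Num.conj v)^T) 0 0.

Definition norm1 w : R := 1 + \sum_i sqabs (to_complex w 0 i).

(* A multiple of the Fubini-Study form, at the point w of the cell Z_0 <> 0. *)
Definition fs_form w h k : R :=
  complex.Im (herm (to_complex k) (to_complex h)
    - herm (to_complex k) (to_complex w) * herm (to_complex w) (to_complex h)
      / (norm1 w)%:C%C) / norm1 w.

Lemma hermZ (a b : C) u v : herm (a *: u) (b *: v) = a * b^* * herm u v.
Proof.
rewrite /herm -scalemxAl map_mxZ linearZ /= -scalemxAr scalerA mxE.
by [].
Qed.

(** The unitary group is transitive on CP^n; |rho|^2 is the squared norm of the homogeneous vector
    since g preserves norms. *)
Lemma unitary_to_origin w : exists (g : 'M[C]_n.+1) (rho : C),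
  [/\ g \is unitarymx, rho != 0, rho * rho^* = (norm1 w)%:C%C &
      homog ord0 w *m g^T = rho *: delta_mx 0 ord0].
Proof.
(* Every row of [A] is the given vector; Gram-Schmidt yields a unitary matrix whose first row spans
   the same line. *)
pose A : 'M[C]_n.+1 := \matrix_(i, j) homog ord0 w 0 j.
pose S := schmidt A; have Su : S \is unitarymx by exact: schmidt_unitarymx.
have : (row ord0 A <= row ord0 S)%MS.
  apply: submx_trans (row_schmidt_sub _ _) _.
  apply/sumsmx_subP => k; rewrite leqn0 => /eqP k0.
  by rewrite genmxE; have -> : k = ord0 by exact: val_inj.
case/submxP => D DE.
have wE : homog ord0 w = D 0 0 *: row ord0 S.
  have -> : homog ord0 w = row ord0 A by apply/rowP => j; rewrite !mxE.
  by rewrite DE [D]mx11_scalar mul_scalar_mx mxE eqxx mulr1n.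
have SS : row ord0 S *m (map_mx Num.conj S)^T = delta_mx 0 ord0.
  rewrite -row_mul; have /unitarymxP := Su; rewrite map_trmx => ->.
  by apply/rowP => j; rewrite !mxE eqxx eq_sym.
exists (map_mx Num.conj S), (D 0 0); split.
- by rewrite conjC_unitary.
- apply/eqP => D0; move: wE; rewrite D0 scale0r => /eqP.
  by rewrite (negbTE (homog_neq0 _ _)).
- have -> : (norm1 w)%:C%C = \sum_i homog ord0 w 0 i * (homog ord0 w 0 i)^*.
    rewrite big_ord_recl homog_ord0 rmorph1 mulr1 /norm1 !rmorphD rmorph1 rmorph_sum /=.
    by congr (_ + _); apply: eq_bigr => i _; rewrite sqabsE homog_lift.
  have SS1 : \sum_j S ord0 j * (S ord0 j)^* = 1.
    have /unitarymxP/matrixP/(_ ord0 ord0) := Su; rewrite !mxE eqxx => SSE.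
    by rewrite -[RHS]SSE; apply: eq_bigr => j _; rewrite !mxE.
  under eq_bigr => i _ do rewrite wE mxE [row _ _ _ _]mxE rmorphM /= mulrACA.
  by rewrite -mulr_sumr SS1 mulr1.
- by rewrite wE -scalemxAl SS.
Qed.

(** The columns of g are orthonormal, and its first row is the conjugate of the homogeneous vector
    divided by conj(rho). Removing the contribution of that row from the orthonormality relations
    leaves the Fubini-Study correction term. *)
Lemma herm_minor0 (g : 'M[C]_n.+1) w (rho : C) u v : g \is unitarymx -> rho != 0 ->
  rho * rho^* = (norm1 w)%:C%C -> homog ord0 w *m g^T = rho *: delta_mx 0 ord0 ->
  herm (u *m minor0 g) (v *m minor0 g) =
  herm u v - herm u (to_complex w) * herm (to_complex w) v / (norm1 w)%:C%C.
Proof.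
move=> gu rho0 rhoE gw.
have gV : g^T *m map_mx Num.conj g = 1%:M.
  have : g^T \is unitarymx by rewrite trmx_unitary.
  by move/unitarymxP; rewrite trmxK.
have wE : homog ord0 w = rho *: row ord0 (map_mx Num.conj g).
  by rewrite -[LHS]mulmx1 -gV mulmxA gw -scalemxAl -rowE.
have g0E l : g ord0 (lift ord0 l) = (to_complex w 0 l)^* / rho^*.
  rewrite -homog_lift wE mxE [row _ _ _ _]mxE [map_mx _ _ _ _]mxE rmorphM /= conjCK.
  by rewrite mulrAC mulfV ?conjC_eq0 // mul1r.
have minorE : minor0 g *m (map_mx Num.conj (minor0 g))^T =
    1%:M - (norm1 w)%:C%C^-1 *: ((map_mx Num.conj (to_complex w))^T *m to_complex w).
  apply/matrixP => a b; have /matrixP/(_ (lift ord0 a) (lift ord0 b)) := gV.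
  rewrite !mxE big_ord_recl /= => E.
  rewrite (inj_eq lift_inj) in E; rewrite -E big_ord1.
  rewrite [X in _ = X + _ - _](_ : _ =
      (norm1 w)%:C%C^-1 * ((to_complex w 0 a)^* * to_complex w 0 b)); last first.
    by rewrite mxE [map_mx _ _ _ _]mxE !g0E rmorphM fmorphV /= !conjCK -rhoE; field;
      rewrite conjC_eq0 rho0.
  have -> : (map_mx Num.conj (to_complex w))^T a ord0 = (to_complex w 0 a)^*.
    by rewrite [LHS]mxE [LHS]mxE.
  rewrite addrAC subrr add0r.
  by apply: eq_bigr => j _; rewrite !mxE.
rewrite /herm map_mxM trmx_mul mulmxA -(mulmxA u) minorE mulmxBr mulmx1 mulmxBl mxE [X in _ + X]mxE.
congr (_ - _); rewrite -scalemxAr -scalemxAl mxE mulrC; congr (_ / _).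
by rewrite mulmxA -[_ *m to_complex w *m _]mulmxA mxE big_ord1.
Qed.

(** The value at w is the value at the origin, pulled back along a unitary map sending w there. *)
Lemma invariant_form om : unitary_invariant om ->
  (om ord0 0)^T = - om ord0 0 ->
  exists kappa : R, forall w h k,
    (h *m om ord0 w *m k^T) 0 0 = kappa * fs_form w h k.
Proof.
move=> om_inv om_skew; have [kappa omE] := invariant_form_origin om_inv om_skew.
exists kappa => w h k; have [g [rho [gu rho0 rhoE gw]]] := unitary_to_origin w.
have [dom act0 J] := act_to_origin rho0 gw.
have form0 u v : (to_real u *m om ord0 0 *m (to_real v)^T) 0 0 =
    kappa * complex.Im (herm v u).
  rewrite omE /to_real mul_row_block !mulmx0 add0r addr0 tr_row_mx mul_row_col.
  rewrite mulmxN !mul_mx_scalar /herm !mxE Im_sumc mulr_sumr -big_split.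
  by apply: eq_bigr => i _; rewrite !mxE Im_mulc Re_conjc Im_conjc /=; ring.
rewrite (om_inv g gu ord0 ord0 w dom) act0 /pullback !mulmxA -[_ *m k^T]mulmxA -trmx_mul.
rewrite !J form0 hermZ (herm_minor0 _ _ gu rho0 rhoE gw) /fs_form.
congr (_ * _).
have -> : rho^-1 * (rho^-1)^* = ((norm1 w)^-1)%:C%C.
  by rewrite fmorphV -invfM rhoE fmorphV.
by rewrite Im_mulc /= mul0r addr0 mulrC.
Qed.

End InvariantForm.

(** * Simultaneous Darboux frame of the two structures *)

Section BruhatFrame.
Variables (R : realType) (n : nat).
Local Notation C := R[i]%C.
Implicit Types (w h k y : 'rV[R]_(n + n)) (j : nat).

(** The index is a natural number so that r_n = 1 is included. *)
Definition tail_norm w j : R := 1 + \sum_(m < n | (j <= m)%N) sqabs (to_complex w 0 m).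

(* Half the differential of |z_i|^2, and the differential of arg z_i. *)
Definition radial w h (i : 'I_n) : R :=
  complex.Re ((to_complex w 0 i)^* * to_complex h 0 i).

Definition angular w h (i : 'I_n) : R :=
  complex.Im ((to_complex w 0 i)^* * to_complex h 0 i) / sqabs (to_complex w 0 i).

Definition tail_radial w h j : R := \sum_(m < n | (j <= m)%N) radial w h m.

Lemma tail_norm_gt0 w j : 0 < tail_norm w j.
Proof. by rewrite ltr_wpDr // sumr_ge0 // => i _; exact: sqabs_ge0. Qed.

Lemma tail_norm0 w : tail_norm w 0 = norm1 w.
Proof. by []. Qed.

Lemma tail_sumS (f : 'I_n -> R) (i : 'I_n) :
  \sum_(m < n | (i <= m)%N) f m = f i + \sum_(m < n | (i < m)%N) f m.
Proof.
rewrite (bigD1 i) //=; congr (_ + _); apply: eq_bigl => m.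
by rewrite -val_eqE /=; case: ltngtP.
Qed.

Lemma has_diff_tail_norm w j :
  has_diff (fun w => tail_norm w j) w (fun h => 2 * tail_radial w h j).
Proof.
have d1 m : has_diff (fun w => sqabs (to_complex w 0 m)) w (fun h => 2 * radial w h m).
  have [dR dI] := has_cdiff_to_complex w m.
  apply: has_diff_eq (has_diffD (has_diffM dR dR) (has_diffM dI dI)) _ => h.
  by rewrite /radial Re_mulc Re_conjc Im_conjc; ring.
apply: has_diff_eq (has_diffD (has_diff_cst 1 w) (has_diff_sum _ (fun m _ => d1 m))) _.
by move=> h; rewrite add0r -mulr_sumr.
Qed.

Lemma jacobian_y_coord w h : h *m jacobian (@y_coord R n) w = to_real (\row_i
  (to_complex w 0 i * (- (tail_radial w h i.+1 / Num.sqrt (tail_norm w i.+1))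
     / tail_norm w i.+1)%:C%C
   + (Num.sqrt (tail_norm w i.+1))^-1%:C%C * to_complex h 0 i)).
Proof.
rewrite /y_coord (jacobian_to_real (M := fun i h =>
  to_complex w 0 i * (- (tail_radial w h i.+1 / Num.sqrt (tail_norm w i.+1))
     / tail_norm w i.+1)%:C%C
   + (Num.sqrt (tail_norm w i.+1))^-1%:C%C * to_complex h 0 i)) //.
move=> i; under eq_fun do rewrite mxE.
have r0 := tail_norm_gt0 w i.+1.
have s0 : Num.sqrt (tail_norm w i.+1) != 0 by rewrite gt_eqF // sqrtr_gt0.
have -> : (fun v => to_complex v 0 i /
    (Num.sqrt (1 + \sum_(m < n | (i < m)%N) sqabs (to_complex v 0 m)))%:C%C) =
    (fun v => to_complex v 0 i * (Num.sqrt (tail_norm v i.+1))^-1%:C%C).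
  by apply/funext => v; rewrite fmorphV.
apply: has_cdiff_eq (has_cdiffM (has_cdiff_to_complex _ _) (has_cdiff_real
  (has_diffV s0 (has_diff_sqrt r0 (has_diff_tail_norm _ _))))) _ => v.
congr (_ * _%:C%C + _); rewrite sqr_sqrtr ?(ltW r0) //.
by field; rewrite s0 gt_eqF.
Qed.

(* The columns are the differentials of log (1 + |y_i|^2) and of arg y_i. *)
Definition y_frame y : 'M[R]_(n + n) :=
  let a := \row_i complex.Re (to_complex y 0 i) in
  let b := \row_i complex.Im (to_complex y 0 i) in
  let s i := sqabs (to_complex y 0 i) in
  block_mx (diag_mx (\row_i (2 * a 0 i / (1 + s i)))) (diag_mx (\row_i (- b 0 i / s i)))
           (diag_mx (\row_i (2 * b 0 i / (1 + s i)))) (diag_mx (\row_i (a 0 i / s i))).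

Lemma mul_y_frame y h : h *m y_frame y =
  row_mx (\row_i (2 * radial y h i / (1 + sqabs (to_complex y 0 i)))) (\row_i angular y h i).
Proof.
rewrite -{1}[h]hsubmxK /y_frame mul_row_block !mul_mx_diag; congr row_mx;
  apply/rowP => i; rewrite !mxE /radial /angular ?Re_mulc ?Im_mulc Re_conjc Im_conjc;
  rewrite !mxE /=; ring.
Qed.

(** In real terms, i d_y /\ d_ybar = -(1/2) d_Re /\ d_Im. *)
Lemma bruhat_mxE y : bruhat_mx y = map_mx (real_complex R)
  (darboux_mx (\row_i (- (1 + sqabs (to_complex y 0 i)) / 2))).
Proof.
have ii : 'i * 'i = -1 :> C by rewrite -expr2 sqrCi.
have entry a b : bruhat_mx y a b = - 2^-1 * \sum_i (1 + sqabs (to_complex y 0 i))%:C%C *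
    ((a == lshift n i)%:R * (b == rshift n i)%:R
     - (a == rshift n i)%:R * (b == lshift n i)%:R).
  rewrite /bruhat_mx mxE summxE !mulr_sumr; apply: eq_bigr => i _.
  rewrite !mxE !big_ord1 !mxE !eqxx /=.
  set ea := (a == _)%:R; set fa := (a == _)%:R; set eb := (b == _)%:R.
  set fb := (b == _)%:R; set c := (1 + _)%:C%C.
  by rewrite -[- 2^-1]mulN1r -ii; field.
have diag (p q : 'I_n) (x : 'I_n -> C) :
    \sum_i x i * ((p == i)%:R * (q == i)%:R) = x p *+ (p == q).
  rewrite (bigD1 p) //= eqxx mul1r eq_sym big1 ?addr0 => [|i ip].
    by rewrite mulr_natr.
  by rewrite eq_sym (negbTE ip) mul0r mulr0.
apply/matrixP => a b; rewrite entry mxE /darboux_mx.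
case: (splitP a) => p ap; case: (splitP b) => q bq.
- have -> : a = lshift n p by exact: val_inj.
  have -> : b = lshift n q by exact: val_inj.
  rewrite block_mxEul mxE rmorph0 big1 ?mulr0 // => i _.
  by rewrite !eq_lrshift !(mulr0, mul0r) subrr mulr0.
- have -> : a = lshift n p by exact: val_inj.
  have -> : b = rshift n q by exact: val_inj.
  rewrite block_mxEur; under eq_bigr => i _ do
    rewrite (inj_eq (@lshift_inj _ _)) (inj_eq (@rshift_inj _ _)) !eq_lrshift mul0r subr0.
  rewrite diag !mxE; case: eqVneq => [->|_]; last by rewrite !mulr0n rmorph0 mulr0.
  by rewrite !mulr1n rmorphM fmorphV rmorphN rmorphD rmorph1 rmorph_nat /=; field.
- have -> : a = rshift n p by exact: val_inj.
  have -> : b = lshift n q by exact: val_inj.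
  rewrite block_mxEdl; under eq_bigr => i _ do
    rewrite (inj_eq (@lshift_inj _ _)) (inj_eq (@rshift_inj _ _)) !eq_rlshift mul0r sub0r mulrN.
  rewrite sumrN diag !mxE; case: eqVneq => [->|_]; last by rewrite !mulr0n !oppr0 rmorph0 mulr0.
  by rewrite !mulr1n rmorphN rmorphM fmorphV rmorphN rmorphD rmorph1 rmorph_nat /=; field.
have -> : a = rshift n p by exact: val_inj.
have -> : b = rshift n q by exact: val_inj.
rewrite block_mxEdr mxE rmorph0 big1 ?mulr0 // => i _.
by rewrite !eq_rlshift !(mulr0, mul0r) subrr mulr0.
Qed.

(** In polar coordinates d_Re /\ d_Im = (1/s) d_s /\ d_theta with s = |y|, so the bracket of log (1
    + s^2) and theta is the constant -1. *)
Lemma y_frame_darboux y : (forall i, to_complex y 0 i != 0) ->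
  (y_frame y)^T *m darboux_mx (\row_i (- (1 + sqabs (to_complex y 0 i)) / 2)) *m y_frame y
  = darboux_mx (const_mx (-1)).
Proof.
rewrite /y_frame; move: (to_complex y) => z z0.
rewrite tr_block_mx /darboux_mx !mulmx_block !tr_diag_mx.
rewrite !(mulmx0, mul0mx, addr0, add0r, mulmxN, mulNmx, mulmx_diag).
have s0 i : complex.Re (z 0 i) ^+ 2 + complex.Im (z 0 i) ^+ 2 != 0.
  by rewrite -/(sqabs (z 0 i)) sqabs_eq0.
have s1 i : 1 + (complex.Re (z 0 i) ^+ 2 + complex.Im (z 0 i) ^+ 2) != 0.
  by rewrite gt_eqF // ltr_wpDr // -/(sqabs (z 0 i)) sqabs_ge0.
congr block_mx; apply/matrixP => p q; rewrite !mxE;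
  case: eqVneq => [->|_]; rewrite ?mulr1n ?mulr0n ?oppr0 ?addr0 //= /sqabs.
all: by field; rewrite ?s0 ?s1.
Qed.

(* The eigenvalues of the recursion operator; [mu w 0 k] is mu_1^(k+1) / lambda. *)
Definition mu w : 'rV[R]_n := \row_k (tail_norm w k.+1 / tail_norm w 0).

(** Since 1 + |y_l|^2 = r_l / r_(l+1), the logarithm of mu_k = r_(k+1) / r_0 is minus the sum of log
    (1 + |y_l|^2) over l <= k; column k expresses dmu_k accordingly. *)
Definition log_mx w : 'M[R]_n := \matrix_(l, k) (- mu w 0 k * (l <= k)%N%:R).

(** Column k expresses d(theta_(k+1) - theta_k); in the last column the missing row n encodes
    theta_n = 0. *)
Definition shift_mx : 'M[R]_n := \matrix_(l, k) ((l == k.+1 :> nat)%:R - (l == k)%:R).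

Lemma sum_pick (f : nat -> R) j : \sum_(l < n) f l * (l == j :> nat)%:R = f j *+ (j < n)%N.
Proof.
have [jn|nj] := ltnP j n; last first.
  by rewrite big1 // => l _; rewrite ltn_eqF ?mulr0 // (leq_trans (ltn_ord l)).
rewrite (bigD1 (Ordinal jn)) //= eqxx mulr1 big1 ?addr0 // => l lj.
by rewrite -[_ == _ :> nat]/(l == Ordinal jn) (negbTE lj) mulr0.
Qed.

Lemma sum_leq (f : nat -> R) (k : 'I_n) :
  \sum_(l < n) f l * (l <= k)%N%:R = \sum_(0 <= l < k.+1) f l.
Proof.
rewrite big_mkord (big_ord_widen n f (ltn_ord k)) [RHS]big_mkcond /=.
by apply: eq_bigr => l _; rewrite ltnS; case: leqP; rewrite ?mulr1 ?mulr0.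
Qed.

(** The difference of the two sides telescopes to m_n t_n - m_0 t_0. *)
Lemma sum_by_parts (m t : nat -> R) : m 0%N = 0 -> t n = 0 ->
  \sum_(i < n) m i.+1 * (t i.+1 - t i) = \sum_(i < n) (m i - m i.+1) * t i.
Proof.
move=> m0 tn; apply/eqP; rewrite -subr_eq0 -sumrB.
rewrite (eq_bigr (fun i : 'I_n => m i.+1 * t i.+1 - m i * t i)) => [|i _]; last by ring.
rewrite -(big_mkord predT (fun i => m i.+1 * t i.+1 - m i * t i)).
by rewrite (telescope_sumr (fun i => m i * t i)) // m0 tn mulr0 mul0r subr0.
Qed.

Lemma log_shift_mx w : (log_mx w)^T *m shift_mx = diag_mx (mu w).
Proof.
apply/matrixP => p q; rewrite !mxE.
under eq_bigr => l _ do rewrite !mxE mulrBr.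
set m := tail_norm w p.+1 / _.
rewrite sumrB (sum_pick (fun l => - m * (l <= p)%N%:R)).
rewrite (sum_pick (fun l => - m * (l <= p)%N%:R) q) ltn_ord mulr1n.
rewrite -(inj_eq val_inj) /=; case: (ltngtP p q) => pq.
- by rewrite !mulr0n !mulr0 mul0rn subrr.
- by rewrite (leq_ltn_trans pq) ?ltn_ord // !mulr1n subrr.
by rewrite mulr0n !mulr1n mulr0 mul0rn mulr1 sub0r opprK.
Qed.

Lemma to_complex_y_coord w i : to_complex (y_coord w) 0 i =
  to_complex w 0 i * ((Num.sqrt (tail_norm w i.+1))^-1)%:C%C.
Proof. by rewrite /y_coord to_realK mxE fmorphV. Qed.

Lemma to_complex_jacobian_y_coord w h i : to_complex (h *m jacobian (@y_coord R n) w) 0 i =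
  to_complex w 0 i * (- (tail_radial w h i.+1 / Num.sqrt (tail_norm w i.+1))
     / tail_norm w i.+1)%:C%C
   + (Num.sqrt (tail_norm w i.+1))^-1%:C%C * to_complex h 0 i.
Proof. by rewrite jacobian_y_coord to_realK [LHS]mxE. Qed.

Lemma sqabs_y_coord w i : sqabs (to_complex (y_coord w) 0 i) =
  sqabs (to_complex w 0 i) / tail_norm w i.+1.
Proof.
rewrite to_complex_y_coord sqabsM sqabs_real exprVn sqr_sqrtr //.
exact: ltW (tail_norm_gt0 _ _).
Qed.

Definition log_angle_frame w := jacobian (@y_coord R n) w *m y_frame (y_coord w).

Lemma mul_log_angle_frame w h : (forall i, to_complex w 0 i != 0) ->
  h *m log_angle_frame w = row_mx
   (\row_(i < n) (2 * (tail_radial w h i / tail_norm w i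
                     - tail_radial w h i.+1 / tail_norm w i.+1)))
   (\row_i angular w h i).
Proof.
move=> w0; rewrite mulmxA mul_y_frame; congr row_mx; apply/rowP => i; rewrite [LHS]mxE [RHS]mxE.
all: have r0 := tail_norm_gt0 w i.+1.
all: have s0 : Num.sqrt (tail_norm w i.+1) != 0 by rewrite gt_eqF // sqrtr_gt0.
(* With the tail norm written as the square of its root, both claims become rational identities. *)
all: have rE : tail_norm w i.+1 = Num.sqrt (tail_norm w i.+1) ^+ 2 by rewrite sqr_sqrtr // ltW.
all: have a0 : sqabs (to_complex w 0 i) != 0 by rewrite sqabs_eq0.
- have -> : tail_radial w h i = radial w h i + tail_radial w h i.+1 by exact: tail_sumS.
  have riE : tail_norm w i = sqabs (to_complex w 0 i) + tail_norm w i.+1.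
    by rewrite /tail_norm tail_sumS addrCA.
  have ri0 := tail_norm_gt0 w i.
  rewrite sqabs_y_coord riE /radial to_complex_y_coord to_complex_jacobian_y_coord.
  rewrite riE in ri0; move: r0 s0 rE a0 ri0; rewrite /sqabs.
  move: (tail_norm w i.+1) (tail_radial w h i.+1) => r Q; move: (Num.sqrt r) => s r0 s0 rE.
  rewrite {}rE in r0 *; move: (to_complex w 0 i) (to_complex h 0 i) => [a b] [c d] /= a0 ri0.
  by field; rewrite s0 gt_eqF.
rewrite /angular sqabs_y_coord to_complex_y_coord to_complex_jacobian_y_coord.
move: r0 s0 rE a0; rewrite /sqabs.
move: (tail_norm w i.+1) (tail_radial w h i.+1) => r Q; move: (Num.sqrt r) => s r0 s0 rE.
rewrite {}rE in r0 *; move: (to_complex w 0 i) (to_complex h 0 i) => [a b] [c d] /= a0.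
by field; rewrite s0 a0.
Qed.

(* The columns are the differentials of mu_k and of arg z_(k+1) - arg z_k, where
   the last angle arg z_n is read as 0. *)
Definition frame w := log_angle_frame w *m block_mx (log_mx w) 0 0 shift_mx.

(* The differential of r_j / r_0, where r_j = tail_norm w j. *)
Definition dmu w h j : R :=
  2 * (tail_radial w h j / tail_norm w 0 - tail_norm w j * tail_radial w h 0 / tail_norm w 0 ^+ 2).

(** The differential of theta_j for a natural number j, extended by 0 for j >= n in accordance with
    theta_n = 0. *)
Definition angle w h j : R := \sum_(l < n) angular w h l * (l == j :> nat)%:R.

Lemma mul_frame w h : (forall i, to_complex w 0 i != 0) ->
  h *m frame w = row_mx (\row_(k < n) dmu w h k.+1)
                        (\row_(k < n) (angle w h k.+1 - angle w h k)).
Proof.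
move=> w0; rewrite mulmxA mul_log_angle_frame // mul_row_block !mulmx0 addr0 add0r.
congr row_mx; apply/rowP => k; rewrite [LHS]mxE [RHS]mxE.
  under eq_bigr => l _ do rewrite [log_mx _ _ _]mxE mxE mulrCA.
  rewrite -mulr_sumr.
  rewrite (sum_leq (fun l => 2 * (tail_radial w h l / tail_norm w l
    - tail_radial w h l.+1 / tail_norm w l.+1)) k) -mulr_sumr.
  under eq_bigr => l _ do rewrite -opprB.
  rewrite sumrN (telescope_sumr (fun l => tail_radial w h l / tail_norm w l)) // opprB.
  rewrite mxE /dmu; move: (tail_norm_gt0 w 0) (tail_norm_gt0 w k.+1).
  move: (tail_norm w 0) (tail_norm w k.+1) => r0 r r0_gt0 r_gt0.
  by field; rewrite !gt_eqF.
rewrite /angle -sumrB; apply: eq_bigr => l _.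
by rewrite !mxE mulrBr.
Qed.

Lemma angle_ord w h (i : 'I_n) : angle w h i = angular w h i.
Proof.
rewrite /angle (bigD1 i) //= eqxx mulr1 big1 ?addr0 // => l li.
by rewrite -[_ == _ :> nat]/(l == i) (negbTE li) mulr0.
Qed.

Lemma angle_n w h : angle w h n = 0.
Proof. by rewrite /angle big1 // => l _; rewrite ltn_eqF ?mulr0. Qed.

Lemma dmu0 w h : dmu w h 0 = 0.
Proof.
rewrite /dmu; have := tail_norm_gt0 w 0; move: (tail_norm w 0) => r r0.
by field; rewrite gt_eqF.
Qed.

(** Summation by parts turns the sum of dmu_i /\ dphi_i into the sum of d(|z_i|^2 / r_0) /\
    dtheta_i, which is compared with the Fubini-Study form term by term in i. *)
Lemma fs_form_frame w h k : (forall i, to_complex w 0 i != 0) ->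
  fs_form w h k = 2^-1 * \sum_(i < n)
    (dmu w h i.+1 * (angle w k i.+1 - angle w k i)
     - dmu w k i.+1 * (angle w h i.+1 - angle w h i)).
Proof.
move=> w0; rewrite sumrB !(sum_by_parts (dmu0 _ _) (angle_n _ _)) -sumrB.
pose P v := \sum_i (to_complex w 0 i)^* * to_complex v 0 i.
have s0 i : sqabs (to_complex w 0 i) != 0 by rewrite sqabs_eq0.
have ReP v : complex.Re (P v) = tail_radial w v 0 by rewrite Re_sumc.
have ImP v : complex.Im (P v) = \sum_i sqabs (to_complex w 0 i) * angular w v i.
  rewrite Im_sumc; apply: eq_bigr => i _.
  by rewrite /angular mulrCA mulfV // mulr1.
have hermP1 v : herm (to_complex v) (to_complex w) = P v.
  by rewrite /herm mxE; apply: eq_bigr => i _; rewrite [X in _ * X]mxE [X in _ * X]mxE mulrC.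
have hermP2 v : herm (to_complex w) (to_complex v) = (P v)^*.
  rewrite /herm mxE rmorph_sum; apply: eq_bigr => i _.
  by rewrite [X in _ * X]mxE [X in _ * X]mxE rmorphM /= conjCK.
have herm_kh : complex.Im (herm (to_complex k) (to_complex h)) =
    \sum_i (radial w h i * angular w k i - angular w h i * radial w k i).
  rewrite /herm mxE Im_sumc; apply: eq_bigr => i _.
  rewrite [X in _ * X]mxE [X in _ * X]mxE.
  move: (s0 i); rewrite /radial /angular /sqabs.
  move: (to_complex w 0 i) (to_complex h 0 i) (to_complex k 0 i) => [a b] [c d] [e f] /= ab0.
  by field.
rewrite /fs_form Im_addc Im_oppc herm_kh hermP1 hermP2 -fmorphV Im_mulc /= mulr0 add0r.
rewrite Im_mulc Re_conjc Im_conjc !ReP -tail_norm0.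
have N0 : tail_norm w 0 != 0 by rewrite gt_eqF ?tail_norm_gt0.
(* The imaginary parts of P are sums of |z_i|^2 dtheta_i; isolating them makes the whole expression
   a single sum over i. *)
transitivity ((\sum_i (radial w h i * angular w k i - angular w h i * radial w k i))
    * (tail_norm w 0)^-1
  + (- (tail_radial w h 0 / tail_norm w 0 ^+ 2)) * complex.Im (P k)
  + tail_radial w k 0 / tail_norm w 0 ^+ 2 * complex.Im (P h)).
  by field.
rewrite !ImP mulr_suml !mulr_sumr -!big_split /=.
apply: eq_bigr => i _; rewrite !angle_ord /dmu /=.
have QE v : tail_radial w v i = radial w v i + tail_radial w v i.+1 by exact: tail_sumS.
have rE : tail_norm w i = sqabs (to_complex w 0 i) + tail_norm w i.+1.
  by rewrite /tail_norm tail_sumS addrCA.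
by rewrite !QE rE; field.
Qed.

(** The brackets of the logarithms and angles are constant by [y_frame_darboux]; the change to mu_k
    and phi_k then multiplies them by [log_mx] and [shift_mx], whose product is diagonal. *)
Lemma frame_bruhat w (P : 'M[R]_(n + n)) : (forall i, to_complex w 0 i != 0) ->
  map_mx (real_complex R) (Defs.pushforward (jacobian (@y_coord R n) w) P)
    = bruhat_mx (y_coord w) ->
  (frame w)^T *m P *m frame w = darboux_mx (- mu w).
Proof.
move=> w0; rewrite bruhat_mxE => /map_mx_inj PE.
have K0 : (log_angle_frame w)^T *m P *m log_angle_frame w = darboux_mx (const_mx (-1)).
  transitivity ((y_frame (y_coord w))^T *m Defs.pushforward (jacobian (@y_coord R n) w) P
      *m y_frame (y_coord w)).
    by rewrite /log_angle_frame /Defs.pushforward trmx_mul !mulmxA.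
  rewrite PE y_frame_darboux // => i; rewrite to_complex_y_coord mulf_neq0 // fmorph_eq0.
  by rewrite invr_eq0 gt_eqF // sqrtr_gt0 tail_norm_gt0.
transitivity ((block_mx (log_mx w) 0 0 shift_mx)^T *m
    darboux_mx (const_mx (-1)) *m block_mx (log_mx w) 0 0 shift_mx).
  by rewrite -K0 /frame trmx_mul !mulmxA.
rewrite /darboux_mx; have -> : diag_mx (const_mx (-1)) = - 1%:M :> 'M[R]_n.
  by rewrite diag_const_mx raddfN.
have -> : diag_mx (- mu w) = - diag_mx (mu w) by rewrite raddfN.
rewrite opprK tr_block_mx !trmx0 !mulmx_block.
rewrite !(mulmx0, mul0mx, addr0, add0r, mulmxN, mulNmx, mulmx1, mul1mx, opprK).
congr block_mx; first by rewrite log_shift_mx.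
by rewrite -[LHS]trmxK trmx_mul trmxK log_shift_mx tr_diag_mx.
Qed.

Lemma frame_form (om : tensor_field R n) kappa w : (forall i, to_complex w 0 i != 0) ->
  (forall h k, (h *m om ord0 w *m k^T) 0 0 = kappa * fs_form w h k) ->
  om ord0 w = (kappa / 2) *: (frame w *m darboux_mx (const_mx 1) *m (frame w)^T).
Proof.
move=> w0 omE; apply/matrixP => a b.
have entry (X : 'M[R]_(n + n)) :
    X a b = ((delta_mx 0 a : 'rV_(n + n)) *m X *m (delta_mx 0 b : 'rV_(n + n))^T) 0 0.
  by rewrite -rowE trmx_delta -colE !mxE.
rewrite entry omE fs_form_frame // mulrA mxE; congr (_ * _); rewrite [RHS]entry.
have conj_mx (K D : 'M[R]_(n + n)) (u v : 'rV_(n + n)) :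
    u *m (K *m D *m K^T) *m v^T = (u *m K) *m D *m (v *m K)^T.
  by rewrite trmx_mul !mulmxA.
rewrite conj_mx !mul_frame // /darboux_mx.
rewrite mul_row_block !mulmx0 add0r addr0 tr_row_mx mul_row_col diag_const_mx.
rewrite mulmxN mulmx1 mulmx1 !mxE -big_split; apply: eq_bigr => i _.
by rewrite !mxE /=; ring.
Qed.

Lemma quotient_on_cell (om pinf : tensor_field R n) kappa w j F :
  (forall i, to_complex w 0 i != 0) -> kappa != 0 -> om ord0 w \in unitmx ->
  (forall h k, (h *m om ord0 w *m k^T) 0 0 = kappa * fs_form w h k) ->
  map_mx (real_complex R) (Defs.pushforward (jacobian (@y_coord R n) w) (pinf ord0 w))
    = bruhat_mx (y_coord w) ->
  (j <= n)%N ->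
  (forall S, F * wedge_pow (bivector_of (dual_bivector om ord0 w)) n S =
     wedge (wedge_pow (bivector_of (pinf ord0 w)) j)
       (wedge_pow (bivector_of (dual_bivector om ord0 w)) (n - j)) S) ->
  F = (kappa / 2) ^+ j / 'C(n, j)%:R * elem_sym (mu w 0) j.
Proof.
move=> w0 kappa0 om_unit omE pinfE jn.
have omK := frame_form w0 omE.
(* The nondegenerate form factors through the frame, which forces the frame to be invertible. *)
have Ku : frame w \in unitmx.
  move: om_unit; rewrite omK !unitmxE detZ !det_mulmx unitrM => /andP[_].
  by rewrite unitrM => /andP[]; rewrite unitrM => /andP[].
have := frame_bruhat w0 pinfE; move: (frame w) omK Ku => K omK Ku PK.
pose J := invmx K.
have FJ : K *m J = 1%:M by exact: mulmxV.
have KJ : (K)^T *m J^T = 1%:M by rewrite -trmx_mul mulVmx // trmx1.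
(* The matrix [darboux_mx (const_mx 1)] squares to -1, so the inverse of its multiple by kappa / 2
   is its multiple by -2 / kappa. *)
have psE : dual_bivector om ord0 w = J^T *m darboux_mx (const_mx (- (2 / kappa))) *m J.
  suff oX : om ord0 w *m (J^T *m darboux_mx (const_mx (- (2 / kappa))) *m J) = 1%:M.
    by rewrite /dual_bivector -[RHS](mulKmx om_unit) oX mulmx1.
  rewrite omK -scalemxAl !mulmxA -[_ *m (K)^T *m _]mulmxA KJ mulmx1.
  rewrite -[_ *m darboux_mx (const_mx 1) *m _]mulmxA.
  have -> : darboux_mx (const_mx 1) *m darboux_mx (const_mx (- (2 / kappa))) =
      (2 / kappa)%:M :> 'M[R]_(n + n).
    rewrite /darboux_mx mulmx_block !diag_const_mx.
    rewrite !(mulmx0, mul0mx, addr0, add0r, mulmxN, mulNmx, mulmx1, mul1mx).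
    by rewrite -raddfN opprK -scalar_mx_block.
  rewrite mul_mx_scalar -scalemxAl FJ scalerA.
  have -> : kappa / 2 * (2 / kappa) = 1 by field.
  by rewrite scale1r.
have pinfJ : pinf ord0 w = J^T *m darboux_mx (- mu w) *m J.
  rewrite -PK !mulmxA -trmx_mul FJ trmx1 mul1mx.
  by rewrite -mulmxA FJ mulmx1.
have Ju : J \in unitmx by rewrite unitmx_inv.
have c0 : - (2 / kappa) != 0 by rewrite oppr_eq0 mulf_neq0 ?invr_eq0.
(* Here d = -1 and c = -2 / kappa, so d / c = kappa / 2. *)
rewrite psE pinfJ -(scaleN1r (mu w)) => FS; rewrite (pencil_quotient Ju c0 jn FS).
by congr (_ ^+ _ / _ * _); field.
Qed.

End BruhatFrame.

(** * Extension from the generic points of the cell *)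

Section GelfandTsetlinLine.
Variables (R : realType) (n : nat).
Local Notation C := R[i]%C.
Implicit Types (Z : 'rV[C]_n.+1).

(** The function mu_k in homogeneous coordinates, which makes sense on all of CP^n. As z_m is
    Z_(m+1) / Z_0 for m counted from 0, the condition m > k becomes i > k + 1. *)
Definition gt_line Z (k : 'I_n) : R :=
  (\sum_(i < n.+1 | (i == ord0) || (k.+1 < i)%N) sqabs (Z 0 i)) / \sum_i sqabs (Z 0 i).

Lemma gt_lineZ (a : C) Z k : a != 0 -> gt_line (a *: Z) k = gt_line Z k.
Proof.
move=> a0; rewrite /gt_line.
under eq_bigr => i _ do rewrite mxE sqabsM.
under [X in _ / X]eq_bigr => i _ do rewrite mxE sqabsM.
rewrite -!mulr_sumr -mulf_div divff ?mul1r //.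
by rewrite sqabs_eq0.
Qed.

Lemma gt_line_homog w k : gt_line (homog ord0 w) k = mu w 0 k.
Proof.
rewrite /gt_line mxE big_mkcond !big_ord_recl /= homog_ord0 /tail_norm.
have -> : sqabs (1 : C) = 1 by rewrite /sqabs /= expr1n expr0n addr0.
congr ((1 + _) / (1 + _)); last by apply: eq_bigr => i _; rewrite homog_lift.
rewrite [RHS]big_mkcond; apply: eq_bigr => i _.
by rewrite homog_lift /bump /= !add1n ltnS.
Qed.

(** The first column of A has norm 1, and the reversed order in [orbit_point] matches its first n -
    k entries with Z_0, Z_n, ..., Z_(k+2). *)
Lemma gt_line_orbit (lambda : R) (A : 'M[C]_n.+1) k : 0 <= lambda -> A \is unitarymx ->
  lambda * gt_line (orbit_point A) k = gt_coord lambda A k 0.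
Proof.
move=> l0 Au; rewrite gt_coordE // /gt_line.
have o0 : orbit_point A 0 ord0 = A ord0 ord0 by rewrite mxE unlift_none.
have oL (i : 'I_n) : orbit_point A 0 (lift ord0 i) = A (lift ord0 (rev_ord i)) ord0.
  by rewrite mxE liftK.
have -> : \sum_i sqabs (orbit_point A 0 i) = 1.
  rewrite -(sqabs_unitary_col ord0 Au) !big_ord_recl o0; congr (_ + _).
  rewrite [RHS](reindex_inj rev_ord_inj) /=; apply: eq_bigr => i _.
  by rewrite oL.
rewrite divr1; congr (_ * _); rewrite big_mkcond [RHS]big_mkcond !big_ord_recl /= o0.
rewrite subn_gt0 ltn_ord; congr (_ + _).
rewrite [RHS](reindex_inj rev_ord_inj) /=; apply: eq_bigr => i _.
rewrite oL /bump /= !add1n ltnS.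
have -> // : ((n - i.+1).+1 < n - k)%N = (k < i)%N.
have := ltn_ord i; have := ltn_ord k; lia.
Qed.

Lemma CP_line (x y : CP R n) : sval x = sval y -> x = y.
Proof. by move=> xy; apply: val_inj. Qed.

Lemma param_chart (l : 'I_n.+1) (Z : 'rV[C]_n.+1) : Z 0 l != 0 ->
  homog l (chart l Z) = (Z 0 l)^-1 *: Z.
Proof.
move=> Zl; apply/rowP => i; rewrite mxE [RHS]mxE; case: (unliftP l i) => [j|] ->.
  by rewrite /chart to_realK mxE mulrC.
by rewrite mulVf.
Qed.

Lemma vlineZ (a : C) (Z : 'rV[C]_n.+1) : a != 0 -> <[a *: Z]>%VS = <[Z]>%VS.
Proof.
move=> a0; apply/eqP; rewrite eqEsubv; apply/andP; split; apply/vlineP.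
  by exists a.
by exists a^-1; rewrite scalerA mulVf // scale1r.
Qed.

Lemma sval_param_chart (l : 'I_n.+1) (Z : 'rV[C]_n.+1) : Z 0 l != 0 ->
  sval (param l (chart l Z)) = <[Z]>%VS.
Proof. by move=> Zl; rewrite /= param_chart // vlineZ // invr_eq0. Qed.

Local Open Scope classical_set_scope.

(** Along the line w + t u, where u adds 1 to every affine coordinate, each such coordinate vanishes
    for at most one real t. Points with small nonzero t are therefore generic, and t tends to 0. *)
Lemma continuous_eq_generic (l : 'I_n.+1) (F G : 'rV[R]_(n + n) -> R) :
  continuous F -> continuous G ->
  (forall w, (forall i, homog l w 0 i != 0) -> F w = G w) -> F =1 G.
Proof.
move=> Fc Gc FG w.
pose u : 'rV[R]_(n + n) := to_real (const_mx 1).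
have ul j : u 0 (lshift n j) = 1 by rewrite /u /to_real row_mxEl !mxE.
have ur j : u 0 (rshift n j) = 0 by rewrite /u /to_real row_mxEr !mxE.
move: u ul ur => u ul ur; pose p (t : R) := w + t *: u.
have homog_p t i : homog l (p t) 0 i = homog l w 0 i + ((i != l)%:R * t)%:C%C.
  rewrite /homog mxE [in RHS]mxE; case: unliftP => [j|] ->.
    rewrite eq_sym neq_lift mul1r !mxE ul ur mulr1 mulr0 addr0.
    by apply/eqP; rewrite eq_complex /= addr0 !eqxx.
  by rewrite eqxx mul0r addr0.
have p0 : p t @[t --> (0 : R)^'] --> w.
  suff : p t @[t --> (0 : R)^'] --> w + 0 *: u by rewrite scale0r addr0.
  by apply: cvgD; [exact: cvg_cst | apply: cvgZr_tmp; exact: nbhs_dnbhs].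
have near_neq (b : R) : \forall t \near (0 : R)^', t != b.
  have [->|b0] := eqVneq b 0; first exact: nbhs_dnbhs_neq.
  have : \forall t \near (0 : R)^', `|t| < `|b| by apply: dnbhs0_lt; rewrite normr_gt0.
  by apply: filterS => t; apply: contraTneq => ->; rewrite ltxx.
have generic : \forall t \near (0 : R)^', forall i, homog l (p t) 0 i != 0.
  apply: filter_forall => i; apply: filterS (near_neq (- complex.Re (homog l w 0 i))) => t.
  rewrite homog_p; have [->|il] := eqVneq i l.
    by rewrite mxE unlift_none mul0r addr0 oner_neq0.
  apply: contraNneq => /(congr1 (@complex.Re R)); rewrite Re_addc /= mul1r.
  by move=> /eqP; rewrite addrC addr_eq0.
have cvg_p (H : 'rV[R]_(n + n) -> R) : continuous H -> H (p t) @[t --> (0 : R)^'] --> H w.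
  by move=> Hc; exact: (continuous_cvg _ (Hc w) p0).
have FGp : F (p t) - G (p t) @[t --> (0 : R)^'] --> F w - G w
  by apply: cvgB; exact: cvg_p.
have FG0 : F (p t) - G (p t) @[t --> (0 : R)^'] --> (0 : R).
  by apply: cvg_near_cst; apply: filterS generic => t /FG ->; rewrite subrr.
apply/eqP; rewrite -subr_eq0; apply/eqP.
exact: (cvg_unique _ FGp FG0).
Qed.

Lemma continuous_gt_line l k : continuous (fun w : 'rV[R]_(n + n) => gt_line (homog l w) k).
Proof.
have sq i : continuous (fun w : 'rV[R]_(n + n) => sqabs (homog l w 0 i)).
  move=> w; case: (unliftP l i) => [j|] ->.
    have [dR dI] := has_cdiff_to_complex w j.
    have [d _] := has_diffD (has_diffM dR dR) (has_diffM dI dI).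
    have -> : (fun w : 'rV[R]_(n + n) => sqabs (homog l w 0 (lift l j))) = fun w =>
        complex.Re (to_complex w 0 j) * complex.Re (to_complex w 0 j) +
        complex.Im (to_complex w 0 j) * complex.Im (to_complex w 0 j).
      by apply/funext => v; rewrite [homog _ _ _ _]mxE liftK /sqabs !expr2.
    exact: differentiable_continuous d.
  have -> : (fun w : 'rV[R]_(n + n) => sqabs (homog l w 0 l)) = fun=> sqabs (1 : C).
    by apply/funext => v; rewrite mxE unlift_none.
  exact: cst_continuous.
have sum_sq (P : pred 'I_n.+1) :
    continuous (fun w : 'rV[R]_(n + n) => \sum_(i < n.+1 | P i) sqabs (homog l w 0 i)).
  by apply: continuous_big => [|i _]; [exact: add_continuous | exact: sq].
move=> w; pose D (v : 'rV[R]_(n + n)) := \sum_i sqabs (homog l v 0 i).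
have D0 : D w != 0.
  rewrite gt_eqF // /D (bigD1 l) //= mxE unlift_none.
  rewrite ltr_wpDr ?sumr_ge0 // => [i _|]; first exact: sqabs_ge0.
  by rewrite lt_neqAle eq_sym sqabs_eq0 oner_eq0 sqabs_ge0.
have Dc : {for w, continuous (fun v => (D v)^-1)} by apply: continuousV D0 (sum_sq predT w).
exact: continuousM (sum_sq (fun i => (i == ord0) || (k.+1 < i)%N) w) Dc.
Qed.

Lemma continuous_elem_sym l j :
  continuous (fun w : 'rV[R]_(n + n) => elem_sym (gt_line (homog l w)) j).
Proof.
apply: continuous_big => [|I _]; first exact: add_continuous.
apply: continuous_big => [|k _]; first exact: mul_continuous.
exact: continuous_gt_line.
Qed.

End GelfandTsetlinLine.

Lemma elem_symZ (R : realType) n (a : R) (x y : 'I_n -> R) j :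
  (forall k, x k = a * y k) -> elem_sym x j = a ^+ j * elem_sym y j.
Proof.
move=> xy; rewrite /elem_sym mulr_sumr; apply: eq_bigr => I /eqP <-.
by rewrite -prodr_const -big_split; apply: eq_bigr => k _; exact: xy.
Qed.

(** For kappa = 0 the invertible matrix at the origin would be 0; n > 0 provides a diagonal entry
    that exhibits the contradiction. *)
Lemma invariant_form_neq0 (R : realType) n (om : tensor_field R n) kappa : (0 < n)%N ->
  om ord0 0 \in unitmx ->
  (forall h k, (h *m om ord0 0 *m k^T) 0 0 = kappa * fs_form 0 h k) -> kappa != 0.
Proof.
move=> n0 om_unit omE; apply/eqP => kappa0.
have om0 : om ord0 0 = 0.
  apply/matrixP => a b; have := omE (delta_mx 0 a) (delta_mx 0 b).
  by rewrite -rowE trmx_delta -colE !mxE kappa0 mul0r.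
have := mulmxV om_unit; rewrite om0 mul0mx.
move=> /matrixP/(_ (lshift n (Ordinal n0)) (lshift n (Ordinal n0)))/eqP.
by rewrite !mxE eqxx eq_sym oner_eq0.
Qed.

Theorem theorem4p1 (R : realType) (n : nat) (lambda : R)
    (omega pi_inf : tensor_field R n) (f : nat -> CP R n -> R) :
  0 < lambda ->
  symplectic_form omega -> unitary_invariant omega ->
  bruhat_poisson pi_inf ->
  (forall j : nat, (1 <= j <= n)%N ->
     bihamiltonian_quotient pi_inf (dual_bivector omega) j (f j)) ->
  exists c : nat -> R, forall j : nat, (1 <= j <= n)%N ->
    c j != 0 /\
    forall (x : CP R n) (A : 'M[R[i]%C]_n.+1),
      A \is unitarymx -> sval x = <[orbit_point A]>%VS ->
      f j x = c j * \sum_(I : {set 'I_n} | #|I| == j)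
                      \prod_(k in I) gt_coord lambda A k 0.
Proof.
move=> l0 [[[_ om_skew] _] _ om_unit] om_inv [_ pinfE] fq.
have [kappa omE] := invariant_form om_inv (om_skew ord0 0).
(* The first two factors come from [quotient_on_cell]; the power of lambda comes from the
   homogeneity of e_j, since the Gelfand-Tsetlin coordinates are lambda mu_k. *)
exists (fun j => (kappa / 2) ^+ j / 'C(n, j)%:R / lambda ^+ j) => j j_n.
have /andP[j0 jn] := j_n; have n0 : (0 < n)%N := leq_trans j0 jn.
have kappa0 := invariant_form_neq0 n0 (om_unit _ _) (omE 0).
have C0 : 'C(n, j)%:R != 0 :> R by rewrite pnatr_eq0 -lt0n bin_gt0.
have lj0 : lambda ^+ j != 0 by rewrite expf_neq0 // gt_eqF.
split.
  have k2 : kappa / 2 != 0 by rewrite mulf_neq0 ?invr_eq0.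
  by rewrite (mulf_neq0 (mulf_neq0 (expf_neq0 j k2) _)) ?invr_eq0.
have [f_smooth fE] := fq j j_n.
pose c := (kappa / 2) ^+ j / 'C(n, j)%:R.
have f_chart l : (fun w => f j (param l w)) =1
    (fun w => c * elem_sym (gt_line (homog l w)) j).
  apply: (@continuous_eq_generic _ _ l).
  - exact: (f_smooth l 0%N).
  - move=> w; have cst_c := @cst_continuous 'rV[R]_(n + n) R c w.
    have M := continuousM cst_c (@continuous_elem_sym _ _ l j w).
    exact: M.
  move=> w w0; set Z := homog l w.
  (* A point without vanishing homogeneous coordinates also lies in the cell Z_0 <> 0, where the
     frame is available. *)
  have -> : param l w = param ord0 (chart ord0 Z).
    by apply: CP_line; rewrite sval_param_chart ?w0.
  have Z_homog := param_chart (w0 ord0).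
  rewrite (quotient_on_cell (w := chart ord0 Z) _ kappa0 (om_unit _ _) (omE _)
    (pinfE _) jn (fE ord0 _)).
    congr (_ * elem_sym _ _); apply/funext => k.
    by rewrite -gt_line_homog Z_homog gt_lineZ // invr_eq0 w0.
  by move=> i; rewrite -homog_lift Z_homog [(_ *: Z) _ _]mxE mulf_neq0 ?invr_eq0 ?w0.
move=> x A Au xA.
have [l Zl] : exists l, orbit_point A 0 l != 0.
  apply/existsP; apply: contraT => /existsPn Z0.
  have Z_eq0 : orbit_point A = 0 by apply/rowP => i; rewrite [RHS]mxE; apply/eqP/negPn/Z0.
  by have := svalP x; rewrite xA Z_eq0 dim_vline eqxx.
have -> : x = param l (chart l (orbit_point A)).
  by apply: CP_line; rewrite sval_param_chart.
rewrite f_chart param_chart // (@elem_symZ _ _ lambda^-1 _ (fun k => gt_coord lambda A k 0)).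
  by rewrite /elem_sym exprVn mulrA.
move=> k; rewrite gt_lineZ ?invr_eq0 // -(gt_line_orbit _ (ltW l0) Au) mulKf //.
by rewrite gt_eqF.
Qed.
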